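(* For each integer $r\ge 2$ there exists $n_0$ such that for all $n>n_0$ the following holds. Let $c\ge1$ and $0\le\lambda<3(r-1)$ be the integers determined by $n=2(r-1)+(c-1)\cdot3(r-1)+\lambda$. If $G$ is a uniformly most reliable graph with $n$ vertices and $r$ redundant edges, then $G$ has a marked structure $(S,L)$ with $r$ redundant edges and $\lambda$ long chains that minimizes the coefficients $\gamma_{k,j}$ in transposed lexicographic order on $(j,k)$, i.e. whose sequence $$\gamma_{1,0},\gamma_{2,0},\dots,\gamma_{3(r-1),0},\ \gamma_{1,1},\gamma_{2,1},\dots,\gamma_{3(r-1),1},\ \gamma_{2,2},\gamma_{3,2},\dots$$ is lexicographically minimal among all cubic marked structures with $r$ redundant edges and $\lambda$ long chains.
   Context: Graphs are finite undirected multigraphs. The redundancy (number of redundant edges) of a graph with $n$ vertices and $m$ edges is $r=m-(n-1)$. If each edge of $G$ fails independently with probability $p$, $U_G(p)$ denotes the probability that $G$ becomes disconnected. A graph with $n$ vertices and $m$ edges is uniformly most reliable if it minimizes $U_G(p)$ among all graphs with $n$ vertices and $m$ edges, for every $p\in[0,1]$ (such a graph need not exist). A cut set is a set of edges whose removal leaves a disconnected graph. A marked (cubic) structure with $r$ redundant edges and $\lambda$ long chains is a pair $(S,L)$ where $S$ is a cubic graph (multigraphs allowed) with $2(r-1)$ vertices, hence $3(r-1)$ edges, and $L\subseteq E(S)$ is a set of $\lambda$ edges, called the long chains. For $1\le k\le 3(r-1)$ and $0\le j\le k$, $\gamma_{k,j}=\gamma_{k,j}(S,L)$ is the number of pairs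 $(X,J)$ such that $X$ is a cut set of $S$ with exactly $k$ edges and $J\subseteq X\cap L$ has exactly $j$ elements. A graph $G$ with $n$ vertices has marked structure $(S,L)$ if $G$ is obtained from $S$ by replacing each edge of $L$ by a path with $c+1$ edges and each edge of $E(S)\setminus L$ by a path with $c$ edges, where $n=2(r-1)+(c-1)\cdot3(r-1)+\lambda$. *)

(* Defs.v *)
From HB Require Import structures.
From mathcomp Require Import all_boot all_order all_algebra.
From mathcomp Require Import reals.

Set Implicit Arguments.
Unset Strict Implicit.
Unset Printing Implicit Defensive.

Import Order.TTheory GRing.Theory Num.Theory.

Local Open Scope ring_scope.

(* The two endpoints of an edge are listed in an arbitrary order, which no
   notion below depends on up to isomorphism. Loops are allowed. *)
Record mgraph := MGraph {
  vert : finType;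
  edge : finType;
  ends : edge -> vert * vert
}.

Definition redundancy (G : mgraph) : int :=
  #|edge G|%:Z - (#|vert G|%:Z - 1).

(* A loop contributes 2. *)
Definition degree (G : mgraph) (v : vert G) : nat :=
  (#|[set e : edge G | (ends e).1 == v]| +
   #|[set e : edge G | (ends e).2 == v]|)%N.

Definition adj_without (G : mgraph) (X : {set edge G}) : rel (vert G) :=
  fun u v => [exists e : edge G,
    (e \notin X) && ((ends e == (u, v)) || (ends e == (v, u)))].

Definition cut_set (G : mgraph) (X : {set edge G}) : bool :=
  ~~ [forall u, forall v, connect (adj_without X) u v].

(* Sum over the possible sets X of failed edges. *)
Definition unreliability (R : realType) (G : mgraph) (p : R) : R :=
  \sum_(X : {set edge G} | cut_set X)
    p ^+ #|X| * (1 - p) ^+ (#|edge G| - #|X|)%N.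

Definition uniformly_most_reliable (R : realType) (G : mgraph) : Prop :=
  forall H : mgraph, #|vert H| = #|vert G| -> #|edge H| = #|edge G| ->
  forall p : R, 0 <= p <= 1 -> unreliability G p <= unreliability H p.

Definition isomorphic (G H : mgraph) : Prop :=
  exists (f : vert G -> vert H) (g : edge G -> edge H),
    [/\ bijective f, bijective g &
        forall e, ends (g e) = (f (ends e).1, f (ends e).2) \/
                  ends (g e) = (f (ends e).2, f (ends e).1)].

Section Subdivision.
Variables (S : mgraph) (len : edge S -> nat).

Definition subdiv_vert : finType :=
  (vert S + {e : edge S & 'I_(len e).-1})%type.

Definition subdiv_edge : finType := {e : edge S & 'I_(len e)}.

(* The i-th vertex, 0 <= i <= len e, of the path replacing e: the first
   endpoint of e if i = 0, the second one if i = len e (the case where insub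
   returns None), and otherwise the (i-1)-th new vertex on e. *)
Definition path_vert (e : edge S) (i : nat) : subdiv_vert :=
  if i == 0%N then inl (ends e).1
  else if (insub i.-1 : option 'I_(len e).-1) is Some j
       then inr (Tagged (fun e => 'I_(len e).-1) j)
       else inl (ends e).2.

(* Replaces each edge e by a path with len e edges, assuming 0 < len e. *)
Definition subdivision : mgraph :=
  @MGraph subdiv_vert subdiv_edge
    (fun ei => (path_vert (tag ei) (tagged ei),
                path_vert (tag ei) (tagged ei).+1)).

End Subdivision.

Record marked_graph := MarkedGraph {
  base : mgraph;
  long : {set edge base}
}.

Definition marked_structure (r lam : nat) (M : marked_graph) : Prop :=
  [/\ #|vert (base M)| = (2 * (r - 1))%N,
      forall v : vert (base M), degree v = 3 &
      #|long M| = lam].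

Definition has_marked_structure (c : nat) (G : mgraph) (M : marked_graph) :
    Prop :=
  isomorphic G
    (subdivision (fun e : edge (base M) => if e \in long M then c.+1 else c)).

Definition gamma (M : marked_graph) (k j : nat) : nat :=
  #|[set XJ : {set edge (base M)} * {set edge (base M)} |
      [&& cut_set XJ.1, #|XJ.1| == k,
          XJ.2 \subset XJ.1 :&: long M & #|XJ.2| == j]]|.

(* Row-major: j is the outer index, k the inner one. *)
Definition gamma_seq (r : nat) (M : marked_graph) : seq nat :=
  [seq gamma M k j | j <- iota 0 (3 * (r - 1)).+1,
                     k <- [seq k <- iota 1 (3 * (r - 1)) | (j <= k)%N]].

Definition gamma_le (r : nat) (M M' : marked_graph) : bool :=
  ((gamma_seq r M : seqlexi nat) <= (gamma_seq r M' : seqlexi nat))%O.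

(* Main.v *)
(* Writing [t = p / (1 - p)], uniform reliability minimises
   [Q_G(t) = sum_(X cut) t^|X|] for every [t >= 0], and each of the two regimes
   below uses one comparison graph.
   Small [t]: [Q_G] has lexicographically minimal coefficients. Let [G] be
   compared with a balanced subdivision of a Moebius ladder, which is cubic and
   3-edge-connected. Then [G] is connected and bridgeless, so it is a
   subdivision of a graph [S] of minimum degree at least 3, which has at most
   [3 (r - 1)] edges. Two edges on a common chain form a cut set, so the number
   of cut pairs of [G] is at least the sum of the ['C(l_e, 2)] over the chains,
   and convexity forces [S] to be cubic and all [l_e] to lie in [{c, c + 1}].
   [t = x / c]: up to terms that are common to all marked structures, [Q_G(t)]
   equals [sum_(k, j) gamma_(k, j) x^k c^-j]. If [gamma_(k0, j0)] is the first
   coefficient where two structures differ, then that term decides the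
   comparison for a small enough [x] depending only on [r] and for all [c] large
   enough in terms of [x]. *)
Require Import Defs.
From HB Require Import structures.
From mathcomp Require Import all_boot all_order all_algebra.
From mathcomp Require Import reals boolp.
From mathcomp Require Import zify ring lra.

Set Implicit Arguments.
Unset Strict Implicit.
Unset Printing Implicit Defensive.

Import Order.TTheory GRing.Theory Num.Theory.

Local Open Scope ring_scope.

(** * Cut sets *)

(* A 2-colouring of the vertices without bichromatic surviving edge. *)
Definition compatible (G : mgraph) (X : {set edge G}) (A : pred (vert G)) :=
  forall e, e \notin X -> A (ends e).1 = A (ends e).2.

(** The component of a vertex is itself a compatible colouring, so the surviving graph is connected
    exactly when every compatible colouring is constant. Connectivity is handled through colourings
    from here on. *)
Lemma noncutP (G : mgraph) (X : {set edge G}) :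
  reflect (forall A, compatible X A -> forall u v, A u = A v) (~~ cut_set X).
Proof.
rewrite /cut_set negbK; apply: (iffP idP) => [/forallP cG A cA u v | noA].
  have /forallP/(_ v)/connectP[p pth ->] := cG u.
  elim: p u pth => //= w p IH u /andP[/existsP[e /andP[eX /orP]] uw pth].
  rewrite -(IH _ pth); have := cA e eX.
  by case: uw => /eqP -> /=.
apply/forallP=> u; apply/forallP=> v.
have cA : compatible X (fun w => connect (adj_without X) u w).
  have sym x y : adj_without X x y = adj_without X y x.
    by apply: eq_existsb => e; rewrite orbC.
  move=> e eX; have e12 : adj_without X (ends e).1 (ends e).2.
    by apply/existsP; exists e; rewrite eX -surjective_pairing eqxx.
  by apply/idP/idP => h; apply: (connect_trans h); apply: connect1 => //;
    rewrite sym.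
by rewrite (noA _ cA v u) connect0.
Qed.

Lemma cutP (G : mgraph) (X : {set edge G}) (A : pred (vert G)) u v :
  compatible X A -> A u != A v -> cut_set X.
Proof.
by move=> cA; apply: contraNT => /noncutP/(_ _ cA u v) ->.
Qed.

Lemma cut_setS (G : mgraph) (X Y : {set edge G}) :
  X \subset Y -> cut_set X -> cut_set Y.
Proof.
move=> XY; apply: contraLR => /noncutP nY; apply/noncutP => A cA.
by apply: nY => e eY; apply: cA; apply: contra eY; apply/subsetP.
Qed.

Definition cut_number (G : mgraph) (k : nat) : nat :=
  #|[set X : {set edge G} | cut_set X & #|X| == k]|.

Lemma isomorphic_sym G H : isomorphic G H -> isomorphic H G.
Proof.
case=> f [g [[f' fK f'K] [g' gK g'K] fg]]; exists f', g'; split.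
- by exists f.
- by exists g.
move=> e; have := fg (g' e); rewrite g'K.
by case=> ->; rewrite !fK -surjective_pairing; [left|right] => //;
  case: (ends _).
Qed.

Lemma iso_noncut G H (f : vert G -> vert H) (g : edge G -> edge H) :
  bijective f -> bijective g ->
  (forall e, ends (g e) = (f (ends e).1, f (ends e).2) \/
             ends (g e) = (f (ends e).2, f (ends e).1)) ->
  forall X : {set edge G}, ~~ cut_set X -> ~~ cut_set (g @: X).
Proof.
move=> [f' fK f'K] bg fg X /noncutP nX; apply/noncutP => A cA u v.
rewrite -(f'K u) -(f'K v); apply: (nX (A \o f)) => e eX /=.
have := cA (g e); rewrite mem_imset; last exact: bij_inj.
by move=> /(_ eX); case: (fg e) => ->.
Qed.

Lemma iso_cut_number G H k : isomorphic G H -> cut_number G k = cut_number H k.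
Proof.
have le G1 G2 : isomorphic G1 G2 -> (cut_number G2 k <= cut_number G1 k)%N.
  case=> f [g [bf bg fg]]; have [g' gK g'K] := bg.
  rewrite /cut_number.
  rewrite -(card_imset (mem [set X | cut_set X & #|X| == k])
                       (imset_inj (can_inj g'K))).
  apply: subset_leq_card; apply/subsetP => _ /imsetP[X /[!inE] /andP[cX sX] ->].
  rewrite card_imset ?sX ?andbT; last exact: can_inj g'K.
  apply: contraLR cX => /(iso_noncut bf bg fg); rewrite -imset_comp.
  by rewrite (eq_imset (g := id)) ?imset_id.
by move=> i; apply/eqP; rewrite eqn_leq !le //; apply: isomorphic_sym.
Qed.

Lemma iso_card G H : isomorphic G H ->
  #|vert G| = #|vert H| /\ #|edge G| = #|edge H|.
Proof. by case=> f [g [bf bg _]]; split; apply: bij_eq_card; eassumption. Qed.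

(** * Cut sets of subdivisions *)

Section Subdiv.
Variables (S : mgraph) (len : edge S -> nat).
Hypothesis len_gt0 : forall e, (0 < len e)%N.
Local Notation H := (subdivision len).

Lemma path_vert0 e : path_vert len e 0 = inl (ends e).1.
Proof. by []. Qed.

Lemma path_vert_len e : path_vert len e (len e) = inl (ends e).2.
Proof.
rewrite /path_vert; case: eqP => [le0|_]; first by have := len_gt0 e;
  rewrite le0.
by case: insubP => // j; rewrite ltnn.
Qed.

Lemma path_vert_inner e (j : 'I_(len e).-1) :
  path_vert len e j.+1 = inr (Tagged (fun e => 'I_(len e).-1) j).
Proof. by rewrite /path_vert /= valK. Qed.

Definition sub_edge e (i : 'I_(len e)) : edge H := Tagged (fun e =>
  'I_(len e)) i.

Definition fiber (e : edge S) : {set edge H} := [set x | tag x == e].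

Lemma card_fiber e : #|fiber e| = len e.
Proof.
rewrite -[RHS]card_ord -cardsT -(card_imset _ (f := @sub_edge e)).
  apply: eq_card => x; rewrite inE; apply/eqP/imsetP => [<-|[i _ ->] //].
  by exists (tagged x) => //; rewrite /sub_edge; case: x.
by move=> i j /eqP; rewrite -tag_eqE /tag_eq /= eqxx tagged_asE => /eqP.
Qed.

Lemma compatible_path (X : {set edge H}) A e a b :
  compatible X A -> (a <= b <= len e)%N ->
  (forall i : 'I_(len e), (a <= i < b)%N -> sub_edge i \notin X) ->
  A (path_vert len e a) = A (path_vert len e b).
Proof.
move=> cA; elim: b => [|b IH] /andP[ab bl] nX.
  by move: ab; rewrite leqn0 => /eqP ->.
move: ab; rewrite leq_eqVlt => /predU1P[-> //|ab].
rewrite IH ?(ltnW bl) ?andbT //; last first.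
  by move=> i /andP[ai ib]; apply: nX; rewrite ai ltnW.
by apply: (cA (sub_edge (Ordinal bl))); apply: nX; rewrite /= -ltnS ab ltnSn.
Qed.

Definition touched (X : {set edge H}) : {set edge S} := [set tag x | x in X].

(** Each chain loses at most one edge. An intact chain still joins its two ends, and an inner vertex
    of a broken chain stays attached to the end on its side of the failed edge. *)
Lemma noncut_subdivision_l (X : {set edge H}) :
  {in X &, injective tag} -> ~~ cut_set (touched X) -> ~~ cut_set X.
Proof.
move=> injX /noncutP nY; apply/noncutP=> A cA.
have Aends e : e \notin touched X ->
    A (inl (ends e).1) = A (inl (ends e).2).
  move=> eX; rewrite -path_vert0 -path_vert_len.
  apply: (compatible_path cA); first exact/andP.
  by move=> i _; apply: contra eX => iX; apply/imsetP; exists (sub_edge i).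
have Al u v : A (inl u) = A (inl v) by apply: (nY (fun w => A (inl w))).
suff Ain x : exists u, A x = A (inl u).
  by move=> x y; have [u ->] := Ain x; have [v ->] := Ain y.
case: x => [u|[e j]]; first by exists u.
rewrite -path_vert_inner.
have jl : (j.+1 <= len e)%N by apply: leq_trans (leq_pred _); apply: ltn_ord.
case: (boolP [exists i : 'I_(len e), (i <= j)%N && (sub_edge i \in X)]).
  case/existsP=> i /andP[ij iX]; exists (ends e).2; rewrite -path_vert_len.
  apply: (compatible_path cA); first by rewrite jl /=.
  move=> i' /andP[ji' _]; apply/negP => i'X.
  have /(congr1 (fun x : edge H =>
    val (tagged x))) /= ii' := injX _ _ iX i'X erefl.
  by move: ji'; rewrite -ii' ltnNge ij.
rewrite negb_exists => /forallP nX; exists (ends e).1; rewrite -path_vert0.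
symmetry; apply: (compatible_path cA); first by rewrite leq0n jl.
by move=> i /= ij; have := nX i; rewrite -ltnS ij.
Qed.

Lemma sub_edge_inj (x y : edge H) :
  tag x = tag y -> tagged x = tagged y :> nat -> x = y.
Proof. by case: x y => [e i] [f j] /= ef; subst f => /val_inj ->. Qed.

Variant path_vert_spec e (i : nat) : subdiv_vert len -> Prop :=
  | PathStart of i = 0%N : path_vert_spec e i (inl (ends e).1)
  | PathInner (j : 'I_(len e).-1) of i = j.+1 :
      path_vert_spec e i (inr (Tagged (fun e => 'I_(len e).-1) j))
  | PathEnd of i = len e : path_vert_spec e i (inl (ends e).2).

Lemma path_vertP e i : (i <= len e)%N -> path_vert_spec e i (path_vert len e i).
Proof.
case: i => [|i] il; first exact: PathStart.
move: il; rewrite leq_eqVlt => /predU1P[il|il].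
  by rewrite il path_vert_len; apply: PathEnd.
have il' : (i < (len e).-1)%N by rewrite -ltnS prednK.
by rewrite -[i]/(nat_of_ord (Ordinal il')) path_vert_inner; apply: PathInner.
Qed.

Lemma noncut_subdivision_inj (X : {set edge H}) :
  ~~ cut_set X -> {in X &, injective tag}.
Proof.
move=> /noncutP nX.
suff inj x y : x \in X -> y \in X -> tag x = tag y -> ~ (tagged x < tagged y)%N.
  move=> x y xX yX xy; apply: sub_edge_inj => //.
  by case: (ltngtP (tagged x : nat) (tagged y)) => // [/inj|/inj] h; case: h.
move=> xX yX xy lxy.
pose i : nat := tagged x; pose i' : nat := tagged y; pose e := tag x.
(* If two edges of one chain fail, the segment between them is cut off; [A] colours that segment.
   The inner vertex [j] is at position [j + 1] of its path, hence the range from [i] to [i' - 1]. *)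
pose A : pred (vert H) := fun z =>
  if z is inr (existT f j) then (f == e) && (i <= j < i')%N else false.
have il' : (i' < len e)%N by rewrite /i' /e xy.
have il : (i < (len e).-1)%N by rewrite -ltnS prednK // (leq_ltn_trans lxy il').
suff cA : compatible X A.
  have := nX A cA (inr (Tagged (fun e =>
    'I_(len e).-1) (Ordinal il))) (inl (ends e).1).
  by rewrite /= eqxx leqnn lxy.
case=> f a aX /=.
have E k : (k <= len f)%N -> A (path_vert len f k) =
  (f == e) && (i < k <= i')%N.
  case/path_vertP => [->|j ->|->] //=; first by rewrite andbF.
  by case: eqP => //= ->; rewrite [X in _ && X]leqNgt il' andbF.
rewrite !E //; last exact: ltnW.
case: eqP => //= fe; rewrite ltnS.
have ai : (a : nat) != i.
  by apply: contraNneq aX => /= ai; rewrite (_ : existT _ _ _ = x) //;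
    apply: sub_edge_inj.
have ai' : (a : nat) != i'.
  by apply: contraNneq aX => /= ai'; rewrite (_ : existT _ _ _ = y) //;
    apply: sub_edge_inj; rewrite //= -xy.
by rewrite ltn_neqAle [in RHS]ltn_neqAle eq_sym ai ai'.
Qed.

Lemma noncut_subdivision_touched (X : {set edge H}) :
  ~~ cut_set X -> ~~ cut_set (touched X).
Proof.
move=> /noncutP nX; apply/noncutP => B cB u v.
(* A colouring [B] of [S] extends along each chain: the colour of the first end is kept up to a
   failed edge, and that of the second end is used beyond it. *)
pose C e k := if [exists i : 'I_(len e), (i < k)%N && (sub_edge i \in X)]
  then B (ends e).2 else B (ends e).1.
pose A : pred (vert H) := fun x => match x with
  | inl u => B u | inr (existT f j) => C f j.+1 end.
suff cA : compatible X A by apply: (nX A cA (inl u) (inl v)).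
case=> f a aX /=.
have E k : (k <= len f)%N -> A (path_vert len f k) = C f k.
  case/path_vertP => [->|j ->|->] //=; rewrite /C.
    by rewrite ifN //; apply/existsP=> -[].
  case: ifPn => //; rewrite negb_exists => /forallP nb; apply/esym/cB.
  apply/imsetP => -[[g i] iX /= fg]; subst g.
  by have := nb i; rewrite ltn_ord iX.
rewrite !E //; last exact: ltnW.
rewrite /C; congr (if _ then _ else _); apply: eq_existsb => i.
rewrite [in RHS]ltnS [in RHS]leq_eqVlt; case: eqP => //= /val_inj ->.
by rewrite /sub_edge (negbTE aX) andbF.
Qed.

Lemma noncut_subdivision (X : {set edge H}) :
  reflect ({in X &, injective tag} /\ ~~ cut_set (touched X)) (~~ cut_set X).
Proof.
apply: (iffP idP) => [nX|[]]; last exact: noncut_subdivision_l.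
by split; [exact: noncut_subdivision_inj|exact: noncut_subdivision_touched].
Qed.

Lemma card_subdivision_edge : #|edge H| = (\sum_e len e)%N.
Proof. by rewrite card_tagged sumnE big_map big_enum; apply: eq_bigr => e _;
  rewrite card_ord. Qed.

Lemma card_subdivision_vert : #|vert H| = (#|vert S| + \sum_e (len e).-1)%N.
Proof.
rewrite card_sum card_tagged sumnE big_map big_enum; congr addn.
by apply: eq_bigr => e _; rewrite card_ord.
Qed.

End Subdiv.

(** A set on which [g] is injective with image [Y] amounts to a choice of one element in each fibre
    over [Y]. Distributing the product over the fibres enumerates these choices. *)
Lemma sum_transversals (T E : finType) (R : comNzRingType) (g : T -> E) (t : R)
    (Y : {set E}) :
  \sum_(X : {set T} | dinjectiveb g X && (g @: X == Y)) t ^+ #|X| =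
  \prod_(e in Y) (#|[set x | g x == e]|%:R * t).
Proof.
pose Q e (o : option T) := if o is Some x then g x == e else false.
transitivity (\prod_(e in Y) \sum_(o | Q e o) t); last first.
  apply: eq_bigr => e _; rewrite sumr_const mulr_natl; congr (_ *+ _).
  have Sinj : injective (@Some T) by move=> ? ? [].
  rewrite -(card_imset _ Sinj); apply: eq_card => -[x|].
    by rewrite (mem_imset _ _ Sinj) inE.
  by symmetry; apply/negbTE/imsetP => -[].
(* Choice functions take the value [None] off [Y]. Below, [F] turns a transversal into its choice
   function and [X_] goes back. *)
rewrite (big_distr_big_dep (None : option T)).
pose F (X : {set T}) : {ffun E -> option T} := [ffun e =>
  [pick x in X | g x == e]].
pose X_ (f : {ffun E -> option T}) := [set x | f (g x) == Some x].
have F_mem (X : {set T}) : {in X &, injective g} -> forall x,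
  x \in X -> F X (g x) = Some x.
  move=> injX x xX; rewrite ffunE;
    case: pickP => [y /andP[yX /eqP/injX ->] //|/(_ x)].
  by rewrite xX eqxx.
have F_some (X : {set T}) e x : F X e = Some x -> x \in X /\ g x = e.
  by rewrite ffunE; case: pickP => // y /andP[yX /eqP gy] [<-].
rewrite [RHS](reindex_onto F X_) /=; last first.
  move=> f /pfamilyP[/subsetP sf fQ]; apply/ffunP => e; rewrite ffunE.
  case: pickP => [x|nx].
    by rewrite inE => /andP[/eqP fx /eqP <-].
  case fe: (f e) => [x|] //; have /fQ: e \in Y by apply: sf; rewrite inE fe.
  rewrite fe /= unfold_in => gx.
  by have /= := nx x; rewrite inE (eqP gx) fe !eqxx.
apply: eq_big => [X|X /andP[/dinjectiveP injX /eqP <-]]; last first.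
  by rewrite prodr_const card_in_imset.
apply/andP/andP => [[/dinjectiveP injX /eqP <-]|[/pfamilyP[/subsetP sF FQ] /eqP
  XE]].
  split; last first.
    apply/eqP/setP => x; rewrite inE; apply/eqP/idP => [/F_some[] //|].
    exact: F_mem.
  apply/pfamilyP; split.
    apply/subsetP => e; rewrite inE; case Fe: (F X e) => [x|] // _.
    by have [xX <-] := F_some _ _ _ Fe; apply: imset_f.
  by move=> _ /imsetP[x xX ->]; rewrite F_mem // unfold_in /=.
have injX : {in X &, injective g}.
  by move=> x y; rewrite -{1 2}XE !inE => /eqP Fx /eqP Fy gxy;
    have [] : Some x = Some y by rewrite -Fx gxy.
split; first exact/dinjectiveP.
apply/eqP/setP => e; apply/imsetP/idP => [[x xX ->]|/FQ].
  by apply: sF; rewrite inE F_mem.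
case Fe: (F X e) => [x|] //; have [xX gx] := F_some _ _ _ Fe.
by exists x.
Qed.

(** By [noncut_subdivision], a non-cut set of the subdivision is a non-cut set [Y] of [S] together
    with one of the [len e] edges on each chain [e] of [Y]. *)
Lemma sum_noncut_subdivision (S : mgraph) (len : edge S -> nat)
    (R : comNzRingType) (t : R) :
  (forall e, 0 < len e)%N ->
  \sum_(X : {set edge (subdivision len)} | ~~ cut_set X) t ^+ #|X| =
  \sum_(Y : {set edge S} | ~~ cut_set Y) \prod_(e in Y) ((len e)%:R * t).
Proof.
move=> lgt0.
rewrite (partition_big (@touched S len) (fun Y => ~~ cut_set Y)) /=; last first.
  by move=> X /(noncut_subdivision lgt0)[].
apply: eq_bigr => Y nY.
transitivity (\sum_(X : {set edge (subdivision len)} | dinjectiveb tag X &&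
  (tag @: X == Y)) t ^+ #|X|).
  apply: eq_bigl => X; apply/andP/andP =>
    [[/(noncut_subdivision lgt0)[/dinjectiveP ? _] ?]//|].
  move=> [/dinjectiveP ? XY]; split=> //; apply/(noncut_subdivision lgt0);
    split=> //.
  by rewrite /touched (eqP XY).
rewrite sum_transversals; apply: eq_bigr => e _.
by rewrite -[X in X%:R]/#|fiber len e| card_fiber.
Qed.

Lemma card_pairs_fiber (S : mgraph) (len : edge S -> nat) :
  #|[set X : {set edge (subdivision len)} | (#|X| == 2) &&
      [exists e, X \subset fiber len e]]| = (\sum_e 'C(len e, 2))%N.
Proof.
have -> : [set X : {set edge (subdivision len)} | (#|X| == 2) &&
   [exists e, X \subset fiber len e]] =
   \bigcup_e [set X : {set edge (subdivision len)} | X \subset fiber len e &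
     #|X| == 2].
  apply/setP => X; rewrite inE;
    apply/andP/bigcupP => [[X2 /existsP[e Xe]]|[e _]].
    by exists e => //; rewrite inE Xe.
  by rewrite inE => /andP[Xe ->]; split=> //; apply/existsP; exists e.
rewrite -sum1_card partition_disjoint_bigcup /=; last first.
  move=> e f ef; apply/pred0P => X /=; apply/negbTE; rewrite !inE.
  apply: contra ef => /andP[/andP[/subsetP Xe X2] /andP[/subsetP Xf _]].
  have : (0 < #|X|)%N by rewrite (eqP X2).
  case/card_gt0P => x xX; have := Xe _ xX; have := Xf _ xX.
  by rewrite !inE => /eqP <- /eqP ->.
by apply: eq_bigr => e _; rewrite sum1_card cards_draws card_fiber.
Qed.

Lemma cut_fiber_pair (S : mgraph) (len : edge S -> nat) :
  (forall e, 0 < len e)%N -> (\sum_e 'C(len e,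
    2) <= cut_number (subdivision len) 2)%N.
Proof.
move=> lgt0; rewrite -card_pairs_fiber; apply: subset_leq_card.
apply/subsetP => X; rewrite !inE => /andP[/[dup] X2 -> /existsP[e /subsetP Xe]].
rewrite andbT; apply: contraT => /(noncut_subdivision lgt0)[injX _].
have /(card_in_imset) /eqP := injX; rewrite (eqP X2) => /eqP c2.
have : (#|tag @: X| <= #|[set e]|)%N.
  apply: subset_leq_card; apply/subsetP => _ /imsetP[x /Xe + ->].
  by rewrite !inE.
by rewrite c2 cards1.
Qed.

Definition three_edge_connected (S : mgraph) :=
  forall Y : {set edge S}, (#|Y| <= 2)%N -> ~~ cut_set Y.

(** At most two failed edges on distinct chains touch at most two edges of [S] and do not disconnect
    it. Hence the only cut sets of this size are the pairs inside one chain. *)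
Lemma three_edge_connected_cut_number (S : mgraph) (len : edge S -> nat) :
  (forall e, 0 < len e)%N -> three_edge_connected S ->
  [/\ cut_number (subdivision len) 0 = 0, cut_number (subdivision len) 1 = 0 &
      cut_number (subdivision len) 2 = \sum_e 'C(len e, 2)]%N.
Proof.
move=> lgt0 S3.
have small (X : {set edge (subdivision len)}) :
  cut_set X -> (#|X| <= 2)%N -> ~~ dinjectiveb tag X.
  move=> cX X2; apply: contraL cX => /dinjectiveP injX.
  apply/(noncut_subdivision lgt0); split=> //; apply: S3.
  by rewrite /touched card_in_imset.
have uniq1 (X : {set edge (subdivision len)}) :
  (#|X| <= 1)%N -> dinjectiveb tag X.
  by move/card_le1P => X1; apply/dinjectiveP => x y xX yX _; have := X1 _ xX y;
    rewrite yX inE => /esym/eqP.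
split.
- apply/eqP; rewrite cards_eq0; apply/eqP/setP => X; rewrite !inE.
  apply/negbTE/negP => /andP[cX X0]; have := small _ cX.
  by rewrite (eqP X0) uniq1 ?(eqP X0) // => /(_ isT).
- apply/eqP; rewrite cards_eq0; apply/eqP/setP => X; rewrite !inE.
  apply/negbTE/negP => /andP[cX X0]; have := small _ cX.
  by rewrite (eqP X0) uniq1 ?(eqP X0) // => /(_ isT).
apply/eqP; rewrite eqn_leq cut_fiber_pair // andbT -card_pairs_fiber.
apply: subset_leq_card; apply/subsetP => X; rewrite !inE => /andP[cX X2].
rewrite X2 /=; have := small _ cX; rewrite (eqP X2) => /(_ isT).
case/cards2P: X2 => x [y [xy ->]] nd; apply/existsP; exists (tag x).
apply/subsetP => z; rewrite !inE => /orP[/eqP->//|/eqP->].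
apply: contraR nd => txy; apply/dinjectiveP => a b; rewrite !inE.
by case/orP => /eqP-> /orP[]/eqP-> // h; move: txy; rewrite ?h ?eqxx // -h eqxx.
Qed.

(** * Decomposition into chains *)

Lemma inj_surj_bij (T U : finType) (f : T -> U) :
  injective f -> (forall y, exists x, f x = y) -> bijective f.
Proof.
move=> injf surjf.
have ex y : exists x, f x == y by have [x <-] := surjf y; exists x.
by exists (fun y => xchoose (ex y)) => [x|y]; [apply: injf|];
  apply/eqP/(xchooseP (ex _)).
Qed.

Section Darts.
Variable G : mgraph.

(** A dart is an edge with a direction. A loop gives two darts at its vertex, so the degree is the
    number of darts leaving the vertex, loops included. *)
Definition dart : finType := (edge G * bool)%type.
Definition rev_dart (d : dart) : dart := (d.1, ~~ d.2).
Definition tail (d : dart) : vert G :=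
  if d.2 then (ends d.1).2 else (ends d.1).1.
Local Notation head d := (tail (rev_dart d)).

Lemma rev_dartK : involutive rev_dart.
Proof. by case=> e b; rewrite /rev_dart /= negbK. Qed.

Lemma rev_dart_neq d : rev_dart d != d.
Proof. by case: d => e b; apply/eqP => -[]; case: b. Qed.

Lemma ends_dart (d : dart) : ends d.1 = (tail d, head d) \/ ends d.1 = (head d,
  tail d).
Proof. by case: d => e []; rewrite /tail /=; case: (ends e); [right|left]. Qed.

Lemma degree_darts v : degree v = #|[set d | tail d == v]|.
Proof.
have pinj (b : bool) : injective (fun e : edge G => (e, b)) by move=> ? ? [].
have -> : [set d | tail d == v] =
    [set (e, false) | e in [set e : edge G | (ends e).1 == v]] :|:
    [set (e, true) | e in [set e : edge G | (ends e).2 == v]].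
  apply/setP => -[e b]; rewrite !inE /tail /=; apply/idP/orP.
    by case: b => h; [right|left]; apply/imsetP; exists e; rewrite ?inE.
  by case=> /imsetP[f]; rewrite inE => ? [-> ->].
rewrite cardsU [X in (_ - X)%N](_ : _ = 0)%N ?subn0; last first.
  apply/eqP; rewrite cards_eq0 -subset0; apply/subsetP => d.
  by rewrite inE => /andP[/imsetP[? _ ->] /imsetP[? _ []]].
by rewrite (card_imset _ (pinj false)) (card_imset _ (pinj true)).
Qed.

Lemma sum_degree : (\sum_v @degree G v = 2 * #|edge G|)%N.
Proof.
transitivity (\sum_v \sum_(d : dart | tail d == v) 1)%N.
  apply: eq_bigr => v _; rewrite degree_darts -sum1_card.
  by apply: eq_bigl => d; rewrite inE.
rewrite -(@partition_big _ _ _ _ _ _ xpredT tail xpredT) //= sum1_card.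
by rewrite card_prod card_bool mulnC.
Qed.

Hypothesis G_connected : ~~ cut_set (set0 : {set edge G}).
Hypothesis degree_ge2 : forall v : vert G, (2 <= degree v)%N.
Hypothesis not_cycle : exists v : vert G, degree v != 2.

(** Branching vertices become the vertices of the skeleton, the others become inner vertices of
    chains. A cycle has no branching vertex, which is what [not_cycle] excludes. *)
Definition branching (v : vert G) := (2 < degree v)%N.

Lemma nonbranching v : ~~ branching v -> degree v = 2.
Proof. by move=> h; apply/eqP; rewrite eqn_leq degree_ge2 leqNgt h. Qed.

(** At a vertex of degree 2 the two darts are exchanged, and the default [d] is never reached; at a
    branching vertex darts are fixed. This is an involution, so composing it with the reversal gives
    a permutation of the darts. *)
Definition other (d : dart) : dart :=
  if branching (tail d) then d
  else odflt d [pick d' | tail d' == tail d & d' != d].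

Lemma tail_other d : tail (other d) = tail d.
Proof. by rewrite /other; case: ifP => // _;
  case: pickP => //= x /andP[/eqP]. Qed.

Lemma other_neq d : ~~ branching (tail d) -> other d != d.
Proof.
move=> nb; rewrite /other (negbTE nb); case: pickP => [x /andP[]//|no].
have [x] : exists x, x \in [set x | tail x == tail d] :\ d.
  apply/card_gt0P; have := nonbranching nb.
  by rewrite degree_darts (cardsD1 d) inE eqxx add1n => -[->].
by rewrite !inE andbC no.
Qed.

Lemma nonbranching_dart d x :
  ~~ branching (tail d) -> tail x = tail d -> x = d \/ x = other d.
Proof.
move=> nb tx; case: (eqVneq x d) => [|xd]; first by left.
case: (eqVneq x (other d)) => [|xo]; first by right.
have: (#|[set x; d; other d]| <= degree (tail d))%N.
  rewrite degree_darts; apply: subset_leq_card; apply/subsetP => y.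
  by rewrite !inE -orbA => /or3P[] /eqP->; rewrite ?tx ?tail_other.
rewrite (nonbranching nb) -setUA cardsU1 !inE negb_or xd xo cards2.
by rewrite eq_sym other_neq.
Qed.

Lemma otherK : involutive other.
Proof.
move=> d; have [b|nb] := boolP (branching (tail d)).
  by rewrite /other b b.
have := other_neq (d := other d); rewrite tail_other => /(_ nb).
by case: (@nonbranching_dart d (other (other d)) nb) => // [|->];
  rewrite ?tail_other ?eqxx.
Qed.

(* Walks along a chain and turns back at its branching end vertices. *)
Definition step (d : dart) : dart := other (rev_dart d).
Local Notation walk d i := (iter i step d).

Lemma step_inj : injective step.
Proof. by move=> x y /(can_inj otherK)/(can_inj rev_dartK). Qed.

Lemma walk_inj i : injective (iter i step).
Proof. by elim: i => //= i IH x y /step_inj/IH. Qed.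

Lemma tail_walkS d i : tail (walk d i.+1) = head (walk d i).
Proof. by rewrite /= tail_other. Qed.

(* The heads of an orbit of [step] avoiding branching vertices would be closed
   under adjacency. *)
Lemma walk_branching d : exists i, branching (head (walk d i)).
Proof.
have [[y [dy by_]]|noy] : (exists y, fconnect step d y /\ branching (head y)) \/
    (forall y, fconnect step d y -> ~~ branching (head y)).
  case: (boolP [exists y, fconnect step d y && branching (head y)]).
    by case/existsP=> y /andP[]; left; exists y.
  rewrite negb_exists => /forallP no; right=> y dy.
  by have := no y; rewrite dy.
  by exists (findex step d y); rewrite iter_findex.
pose A v := [exists y, fconnect step d y && (head y == v)].
have cA : compatible set0 A.
  suff hA z : A (tail z) -> A (head z).
    move=> e _; apply/idP/idP; first exact: (hA (e, false)).
    exact: (hA (e, true)).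
  case/existsP=> y /andP[dy /eqP hy].
  have nb := noy y dy.
  (* A dart leaving [head y] either retraces [y], ending at the head of the predecessor of [y] in
     the orbit, or is [step y]. *)
  have [->|->] := nonbranching_dart nb (esym hy).
    rewrite rev_dartK.
    have dy' : fconnect step d (finv step y).
      by apply: connect_trans dy _; apply: fconnect_finv.
    apply/existsP; exists (finv step y); rewrite dy'.
    by rewrite -[X in _ == tail X](f_finv step_inj y) tail_other eqxx.
  apply/existsP; exists (step y); rewrite eqxx andbT.
  exact: connect_trans dy (fconnect1 _ _).
have [w nw] := not_cycle.
have: A w.
  rewrite -((noncutP _ G_connected) _ cA (head d)).
  by apply/existsP; exists d; rewrite connect0 eqxx.
case/existsP=> y /andP[/noy nb /eqP hy]; move: nw.
by rewrite -hy nonbranching.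
Qed.

Definition last_step d := ex_minn (walk_branching d).

Lemma last_stepP d : branching (head (walk d (last_step d))).
Proof. by rewrite /last_step; case: ex_minnP. Qed.

Lemma before_last d i : (i < last_step d)%N -> ~~ branching (head (walk d i)).
Proof.
rewrite /last_step; case: ex_minnP => m _ min im; apply/negP => /min.
by rewrite leqNgt im.
Qed.

Lemma le_last d k : (forall i, (i < k)%N -> ~~ branching (head (walk d i))) ->
  (k <= last_step d)%N.
Proof.
by move=> nb; rewrite leqNgt; apply/negP => /nb; rewrite last_stepP.
Qed.

(** The initial dart of the same chain when it is walked from the opposite end. *)
Definition partner d := rev_dart (walk d (last_step d)).

(** Reversal conjugates [step] to its inverse, because [other] is an involution. *)
Lemma walk_rev d k i : (i <= k)%N ->
  walk (rev_dart (walk d k)) i = rev_dart (walk d (k - i)).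
Proof.
elim: i => [|i IH] ik; first by rewrite subn0.
by rewrite iterS IH ?(ltnW ik) // -(subnSK ik) iterS /step rev_dartK otherK.
Qed.

Lemma walk_partner d i : (i <= last_step d)%N ->
  walk (partner d) i = rev_dart (walk d (last_step d - i)).
Proof. exact: walk_rev. Qed.

Lemma head_walk_partner d i : (i < last_step d)%N ->
  ~~ branching (head (walk (partner d) i)).
Proof.
move=> il; rewrite walk_partner ?(ltnW il) // rev_dartK -(subnSK il) tail_walkS.
by apply: before_last; rewrite ltn_subrL (leq_ltn_trans _ il).
Qed.

Lemma branching_partner d : branching (tail (partner d)).
Proof. exact: last_stepP. Qed.

Lemma last_step_partner d : branching (tail d) -> last_step (partner d) =
  last_step d.
Proof.
move=> bd; apply/eqP; rewrite eqn_leq [X in _ && X]le_last ?andbT; last first.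
  by move=> i /head_walk_partner.
rewrite leqNgt; apply/negP => /before_last.
by rewrite walk_partner // subnn rev_dartK bd.
Qed.

Lemma partnerK d : branching (tail d) -> partner (partner d) = d.
Proof.
move=> bd; rewrite {1}/partner last_step_partner // walk_partner // subnn.
by rewrite rev_dartK.
Qed.

(** A chain equal to its own reversal would have either a middle edge whose dart is its own reverse,
    or a middle vertex of degree 2 at which [other] fixes a dart. The parity of [last_step d] tells
    which. *)
Lemma partner_neq d : partner d != d.
Proof.
apply/eqP => pd; have rd i : (i <= last_step d)%N -> walk d i =
  rev_dart (walk d (last_step d - i)).
  by move=> il; rewrite -walk_partner // pd.
have := odd_double_half (last_step d); set h := (last_step d)./2.
case: (odd _) => /= lh.
  have hl : (h < last_step d)%N by rewrite -lh add1n ltnS -addnn leq_addr.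
  have := rd _ hl; rewrite -{1}lh add1n -addnn subSS addnK iterS => e.
  by case/eqP: (other_neq (before_last hl)).
have := rd h; rewrite -lh add0n -addnn leq_addr addnK => /(_ isT)/esym/eqP.
by rewrite (negbTE (rev_dart_neq _)).
Qed.

(** Walk from the reverse of [x] until a branching vertex and turn round: the walk back passes
    through [x]. *)
Lemma walk_cover x : exists d i,
  [/\ branching (tail d), (i <= last_step d)%N & walk d i = x].
Proof.
exists (partner (rev_dart x)), (last_step (rev_dart x)); split.
- exact: branching_partner.
- by apply: le_last => i /head_walk_partner.
- by rewrite walk_partner // subnn rev_dartK.
Qed.

(** Cancelling the common steps leaves [d] on the walk from [d']; after a positive number of steps,
    the branching tail of [d] would be an inner vertex of that chain. *)
Lemma walk_start_inj d d' i j :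
  branching (tail d) -> branching (tail d') ->
  (i <= last_step d)%N -> (j <= last_step d')%N ->
  walk d i = walk d' j -> i = j /\ d = d'.
Proof.
wlog ij : d d' i j / (i <= j)%N.
  move=> W bd bd' il jl e; case/orP: (leq_total i j) => h; first exact: W.
  by have [] := W d' d j i h bd' bd jl il (esym e).
move=> bd bd' il jl; rewrite -(subnKC ij) iterD => /walk_inj dE.
case ji: (j - i)%N dE => [|k] dE; first by rewrite addn0.
have kl : (k < last_step d')%N.
  by apply: leq_trans jl; rewrite -ji leq_subr.
by have := before_last kl; rewrite -tail_walkS -dE bd.
Qed.

(* Every chain is walked from both of its ends; the enumeration rank selects one
   of the two initial darts. *)
Definition chosen (d : dart) :=
  branching (tail d) && (enum_rank d < enum_rank (partner d))%N.

Lemma chosen_partner d : branching (tail d) -> chosen d || chosen (partner d).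
Proof.
move=> bd; rewrite /chosen bd branching_partner partnerK //=.
by rewrite -neq_ltn (inj_eq val_inj) (inj_eq enum_rank_inj) eq_sym partner_neq.
Qed.

(** The reversed dart lies on the walk from [partner d'], so [d] would be [partner d']. Of two
    partners only the one of smaller rank is chosen. *)
Lemma chosen_walk_rev d d' i j : chosen d -> chosen d' ->
  (i <= last_step d)%N -> (j <= last_step d')%N ->
  walk d i <> rev_dart (walk d' j).
Proof.
move=> /andP[bd rd] /andP[bd' rd'] il jl.
rewrite -(subKn jl) -walk_partner ?leq_subr // => /walk_start_inj[] //.
- exact: branching_partner.
- by rewrite last_step_partner // leq_subr.
move=> _ dd'; move: rd; rewrite dd' partnerK //.
by rewrite ltnNge (ltnW rd').
Qed.

Definition skel_vert : finType := {v : vert G | branching v}.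
Definition skel_edge : finType := {d : dart | chosen d}.

Lemma branching_tail (e : skel_edge) : branching (tail (val e)).
Proof. by case/andP: (valP e). Qed.

Definition skeleton : mgraph := @MGraph skel_vert skel_edge (fun e =>
  (Sub _ (branching_tail e), Sub _ (branching_partner (val e)))).

Definition chain_length (e : edge skeleton) := (last_step (val e)).+1.

Local Notation H := (subdivision chain_length).

Definition chain_vert (x : vert H) : vert G :=
  match x with
  | inl v => val v
  | inr (existT e j) => head (walk (val e) j)
  end.

Definition chain_edge (x : edge H) : edge G :=
  (walk (val (tag x)) (tagged x)).1.

Lemma chain_path_vertS e k : (k <= last_step (val e))%N ->
  chain_vert (path_vert chain_length e k.+1) = head (walk (val e) k).
Proof.
move=> kl; have lgt0 f : (0 < chain_length f)%N by [].
have kl' : (k.+1 <= chain_length e)%N by [].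
case: (path_vertP lgt0 kl') => [//|j [->] //|[->] //].
Qed.

Lemma chain_path_vert e k : (k <= last_step (val e))%N ->
  chain_vert (path_vert chain_length e k) = tail (walk (val e) k).
Proof. by case: k => // k kl; rewrite chain_path_vertS ?tail_walkS // ltnW. Qed.

Lemma dart_edge_inj (x y : dart) : x.1 = y.1 -> x = y \/ x = rev_dart y.
Proof. by case: x y => [e b] [f c] /= ->; case: b c => [] []; auto. Qed.

(** Two darts of the same edge are equal or mutually reverse, and chosen walks exclude the second
    case. Every edge is reached because a chain whose initial dart is not chosen is walked from its
    partner. *)
Lemma chain_edge_bij : bijective chain_edge.
Proof.
have lgt0 f : (0 < chain_length f)%N by [].
apply: inj_surj_bij => [x y|e].
  have xl : (tagged x <= last_step (val (tag x)))%N by rewrite -ltnS ltn_ord.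
  have yl : (tagged y <= last_step (val (tag y)))%N by rewrite -ltnS ltn_ord.
  case/dart_edge_inj => [/walk_start_inj[]|/chosen_walk_rev[]] //;
    try exact: branching_tail; try exact: valP.
  by move=> ij /val_inj ee; apply: sub_edge_inj.
have [d [i [bd il de]]] := walk_cover (e, false).
case/orP: (chosen_partner bd) => cd.
  by exists (sub_edge (e := exist _ d cd : edge skeleton) (Ordinal (il :
    (i < chain_length (exist _ d cd))%N))); rewrite /chain_edge /= de.
have il' : (last_step d - i < chain_length (exist _ (partner d) cd))%N.
  by rewrite ltnS /= last_step_partner // leq_subr.
exists (sub_edge (e := exist _ (partner d) cd : edge skeleton) (Ordinal il')).
by rewrite /chain_edge /= walk_partner ?leq_subr // subKn // de.
Qed.

Lemma chain_vert_bij : bijective chain_vert.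
Proof.
have jlt (e : edge skeleton) (j : 'I_(chain_length e).-1) :
  (j < last_step (val e))%N.
  exact: ltn_ord.
apply: inj_surj_bij => [|v].
  have nb (e : edge skeleton) (j : 'I_(chain_length e).-1) (w : skel_vert) :
      val w <> head (walk (val e) j).
    by move=> h; have := before_last (jlt e j); rewrite -h (valP w).
  case=> [v|[e j]] [w|[f k]] /= => [/val_inj->//|/nb[]|/esym/nb[]|hd].
  have ej := jlt e j; have fk := jlt f k.
  have [h|h] := nonbranching_dart (before_last ej) (esym hd).
    have [] := walk_start_inj (branching_tail f) (branching_tail e) _ _
      (can_inj rev_dartK h).
    - exact: ltnW.
    - exact: ltnW.
    move=> kj /val_inj fe; subst f; congr inr; congr existT.
    exact/val_inj/esym.
  have [] := chosen_walk_rev (valP e) (valP f) ej (ltnW fk).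
  by rewrite h.
have [bv|nv] := boolP (branching v).
  by exists (inl (exist _ v bv)).
have : (0 < degree v)%N by apply: leq_trans (degree_ge2 v).
rewrite degree_darts => /card_gt0P[x]; rewrite inE => /eqP tx.
have [d [i [bd il de]]] := walk_cover (rev_dart x).
have hv : head (walk d i) = v by rewrite de rev_dartK.
have {}il : (i < last_step d)%N.
  rewrite ltn_neqAle il andbT; apply: contraNneq nv => ie.
  by rewrite -hv ie last_stepP.
case/orP: (chosen_partner bd) => cd.
  by exists (inr (existT _ (exist _ d cd : edge skeleton) (Ordinal il))).
(* The head of dart [i] is the tail of dart [i + 1], hence the head of its reverse, which the walk
   from the partner reaches after [last_step d - i.+1] steps. *)
have il' : (last_step d - i.+1 < (chain_length (exist _ (partner d) cd)).-1)%N.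
  by rewrite /chain_length /= last_step_partner // ltn_subrL (leq_ltn_trans _
    il).
exists (inr (existT _ (exist _ (partner d) cd : edge skeleton) (Ordinal il'))).
by rewrite /= walk_partner ?leq_subr // subKn // rev_dartK tail_walkS.
Qed.

Lemma chain_iso : isomorphic H G.
Proof.
exists chain_vert, chain_edge; split.
- exact: chain_vert_bij.
- exact: chain_edge_bij.
case=> e i; have il : (i <= last_step (val e))%N by rewrite -ltnS ltn_ord.
have := ends_dart (walk (val e) i).
by rewrite -chain_path_vert // -chain_path_vertS.
Qed.

(** Each dart of [G] leaving a branching vertex is a chosen dart or the partner of one, so it is
    accounted for by an end of a skeleton edge there, and no degree drops. *)
Lemma skeleton_degree (v : vert skeleton) : (3 <= degree v)%N.
Proof.
apply: leq_trans (valP v) _; rewrite degree_darts.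
pose A1 := [set e : edge skeleton | (ends e).1 == v].
pose A2 := [set e : edge skeleton | (ends e).2 == v].
have sub : [set d | tail d == val v] \subset
    [set val e | e in A1] :|: [set partner (val e) | e in A2].
  apply/subsetP => d; rewrite inE => /eqP dv.
  have bd : branching (tail d) by rewrite dv (valP v).
  case/orP: (chosen_partner bd) => cd; rewrite inE; apply/orP; [left|right].
    apply/imsetP; exists (exist _ d cd : edge skeleton) => //.
    by rewrite inE; apply/eqP/val_inj.
  apply/imsetP; exists (exist _ (partner d) cd : edge skeleton); last first.
    by rewrite /= partnerK.
  by rewrite inE; apply/eqP/val_inj; rewrite /= partnerK.
apply: leq_trans (subset_leq_card sub) _.
apply: leq_trans (leq_card_setU _ _) _.
by apply: leq_add; apply: leq_imset_card.
Qed.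

End Darts.

Theorem chain_decomposition (G : mgraph) :
  ~~ cut_set (set0 : {set edge G}) -> (forall v : vert G, 2 <= degree v)%N ->
  (exists v : vert G, degree v != 2) ->
  exists (S : mgraph) (len : edge S -> nat),
    [/\ isomorphic G (subdivision len), forall e, (0 < len e)%N &
        forall v : vert S, (3 <= degree v)%N].
Proof.
move=> cG dG nG; exists (skeleton cG dG nG), (@chain_length G cG dG nG);
  split=> //.
- exact/isomorphic_sym/chain_iso.
- exact: skeleton_degree.
Qed.

(** * Moebius ladders *)

(** The sequence changes once on the way to the deviating index and once on the way back. *)
Lemma two_changes (a : nat -> bool) (N i : nat) :
  a N = a 0%N -> (i <= N)%N -> a i != a 0%N ->
  exists p q, [/\ (p < q < N)%N, a p != a p.+1 & a q != a q.+1].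
Proof.
have change (m n : nat) : (m <= n)%N -> a m != a n ->
    exists2 p, (m <= p < n)%N & a p != a p.+1.
  elim: n => [|n IH]; first by rewrite leqn0 => /eqP->; rewrite eqxx.
  rewrite leq_eqVlt => /predU1P[->|mn]; first by rewrite eqxx.
  case: (eqVneq (a n) (a n.+1)) => [<- /(IH mn)[p mp ap]|an _].
    by exists p => //; lia.
  by exists n => //; lia.
move=> aN iN ai; rewrite eq_sym in ai.
have [p pi ap] := change _ _ (leq0n i) ai.
rewrite -aN eq_sym in ai.
have [q qi aq] := change _ _ iN ai.
by exists p, q; split=> //; lia.
Qed.

Section Moebius.
Variable k : nat.

Let step_proof (n : nat) (i : 'I_(2 * k)) : ((i + n) %% (2 * k) < 2 * k)%N.
Proof. by rewrite ltn_mod; case: i; case: (2 * k)%N. Qed.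
Definition shift n (i : 'I_(2 * k)) : 'I_(2 * k) := Ordinal (step_proof n i).

Let chord_proof (i : 'I_k) : (i < 2 * k)%N.
Proof. by apply: leq_trans (ltn_ord i) _; rewrite leq_pmull. Qed.

(** [inl] gives the rim, a cycle of length [2 * k], and [inr] the chords between opposite vertices.
    For [k = 1] this is the graph with three parallel edges, which serves [r = 2]. *)
Definition moebius_ladder : mgraph :=
  @MGraph 'I_(2 * k) ('I_(2 * k) + 'I_k)%type
    (fun e => match e with
     | inl i => (i, shift 1 i)
     | inr i => (Ordinal (chord_proof i), shift k (Ordinal (chord_proof i)))
     end).

(** A non-constant colouring changes at least twice along the rim. If some chord is bichromatic,
    this makes three failed edges. Otherwise the colouring has period [k] on the rim, so half of the
    rim already contains two changes and the other half repeats them. *)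
Lemma moebius_three_edge_connected :
  (0 < k)%N -> three_edge_connected moebius_ladder.
Proof.
move=> k0 X X2; apply/noncutP => A cA.
have k2 : (0 < 2 * k)%N by rewrite muln_gt0.
pose o (n : nat) : 'I_(2 * k) := Ordinal (ltn_pmod n k2).
pose a n := A (o n).
have oval (i : 'I_(2 * k)) : o i = i by apply: val_inj; rewrite /= modn_small.
suff a0 (n : nat) : (n <= 2 * k)%N -> a n = a 0%N.
  by move=> u v; rewrite -(oval u) -(oval v) -/(a u) -/(a v) !a0 // ltnW.
have cyc (i : nat) : (i < 2 * k)%N -> a i != a i.+1 -> inl (o i) \in X.
  move=> ik; apply: contraR => /cA /= h; apply/eqP; rewrite /a h; congr A.
  by apply: val_inj; rewrite /= modnDml addn1.
have chord (i : nat) (ik : (i < k)%N) :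
  a i != a (i + k)%N -> inr (Ordinal ik) \in X.
  apply: contraR => /cA /= h; apply/eqP; rewrite /a.
  rewrite (_ : o i = Ordinal (chord_proof (Ordinal ik))); last first.
    by apply: val_inj; rewrite /= modn_small //; lia.
  rewrite h; congr A; apply: val_inj; rewrite /=.
  by rewrite modn_small //; lia.
have a2k : a (2 * k)%N = a 0%N by congr A; apply: val_inj;
  rewrite /= modnn mod0n.
have no3 (x y z : edge moebius_ladder) : x \in X -> y \in X -> z \in X ->
    x != y -> x != z -> y != z -> False.
  move=> xX yX zX xy xz yz.
  have : (#|[set x; y; z]| <= #|X|)%N.
    by apply: subset_leq_card; apply/subsetP => w;
      rewrite !inE -orbA => /or3P[]/eqP->.
  by rewrite -setUA cardsU1 !inE negb_or xy xz cards2 yz => /leq_trans/(_ X2).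
have oneq (p q : nat) : (p < 2 * k)%N -> (q < 2 * k)%N -> p != q ->
    (inl (o p) : edge moebius_ladder) != inl (o q).
  move=> pk qk pq; apply: contra_neq pq => -[].
  by rewrite !modn_small.
rename n into i; move=> ik; apply/eqP; apply: contraT => ai; exfalso.
case: (boolP [forall j : 'I_k, a j == a (j + k)%N]) => [/forallP per|].
  have ak : a k = a 0%N by have /eqP := per (Ordinal k0); rewrite add0n => <-.
  have [i' i'k ai'] : exists2 i', (i' <= k)%N & a i' != a 0%N.
    case: (ltnP i k) => hik; first by exists i => //; lia.
    exists (i - k)%N; first lia.
    case: (ltnP (i - k) k) => h.
      by have /eqP /= -> := per (Ordinal h); rewrite subnK.
    by move: ai; rewrite (_ : i = 2 * k)%N ?a2k ?eqxx //; lia.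
  have [p [q [pq ap aq]]] := two_changes ak i'k ai'.
  have [pk p1k] : (p < k /\ p.+1 < k)%N by clear -pq; lia.
  have ap' : a (p + k)%N != a (p + k).+1.
    have /eqP /= <- := per (Ordinal pk).
    by have /eqP /= := per (Ordinal p1k); rewrite addSn => <-.
  have [p2k q2k pk2k] : [/\ p < 2 * k, q < 2 * k & p + k < 2 * k]%N.
    by clear -pq; split; lia.
  have [pNq pNpk qNpk] : [/\ p != q, p != p + k & q != p + k]%N.
    by clear -pq; split; lia.
  apply: (no3 (inl (o p)) (inl (o q)) (inl (o (p + k)%N))).
  - exact: cyc.
  - exact: cyc.
  - exact: cyc.
  - exact: oneq.
  - exact: oneq.
  - exact: oneq.
rewrite negb_forall => /existsP[j /chord jX].
have [p [q [pq ap aq]]] := two_changes a2k ik ai.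
have [p2k q2k pNq] : [/\ p < 2 * k, q < 2 * k & p != q]%N.
  by clear -pq; split; lia.
apply: (no3 (inl (o p)) (inl (o q)) (inr j)) => //.
- exact: cyc.
- exact: cyc.
- by case: j jX.
- exact: oneq.
Qed.

End Moebius.

(** * Comparison of reliability polynomials *)

Lemma dominant_coef (R : realFieldType) (a : nat -> R) (K k0 : nat) (B eta x :
  R) :
  (k0 <= K)%N -> (forall k, (k < k0)%N -> a k = 0) -> eta <= a k0 ->
  (forall k, (k <= K)%N -> `|a k| <= B) -> 0 < x <= 1 ->
  x * (B * K.+1%:R) <= eta / 2 ->
  x ^+ k0 * (eta / 2) <= \sum_(k < K.+1) a k * x ^+ k.
Proof.
move=> k0K a0 ak0 aB /andP[x0 x1] xB.
have B0 : 0 <= B by apply: le_trans (aB _ k0K).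
have Bx0 : 0 <= B * x ^+ k0.+1 by rewrite mulr_ge0 // exprn_ge0 // ltW.
(* Each term of degree above [k0] is at least [- B * x ^+ k0.+1]. Charging this loss to all [K.+1]
   indices costs at most half of [eta * x ^+ k0]. *)
apply: (@le_trans _ _ (\sum_(k < K.+1) ((k == k0 :> nat)%:R * (eta * x ^+ k0) -
  B * x ^+ k0.+1))).
  rewrite big_split /= sumr_const card_ord -mulr_suml.
  rewrite (bigD1 (Ordinal (k0K : (k0 < K.+1)%N))) //= eqxx big1 ?addr0 ?mul1r;
    last first.
    by move=> i; rewrite -val_eqE /= => /negbTE ->.
  have xk : 0 < x ^+ k0 by rewrite exprn_gt0.
  rewrite mulNrn -mulr_natr exprS.
  have := ler_wpM2l (ltW xk) xB; lra.
apply: ler_sum => k _; case: (ltngtP k k0) => [kk|kk|->];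
  rewrite ?mul0r ?mul1r ?add0r.
- by rewrite a0 // mul0r oppr_le0.
- have := aB k; rewrite -ltnS ltn_ord => /(_ isT);
  rewrite ler_norml => /andP[akB _].
  apply: (@le_trans _ _ (- (B * x ^+ k))).
    by rewrite lerN2 ler_wpM2l // ler_wiXn2l // ltW.
  by rewrite -mulNr ler_wpM2r // exprn_ge0 // ltW.
- have := ler_wpM2r (exprn_ge0 k0 (ltW x0)) ak0; lra.
Qed.

Definition cut_poly (R : nzSemiRingType) (G : mgraph) (t : R) : R :=
  \sum_(X : {set edge G} | cut_set X) t ^+ #|X|.

Lemma cut_polyE (R : nzSemiRingType) (G : mgraph) (t : R) :
  cut_poly G t = \sum_(k < #|edge G|.+1) (cut_number G k)%:R * t ^+ k.
Proof.
rewrite /cut_poly (partition_big (fun X : {set edge G} =>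
  inord #|X| : 'I_#|edge G|.+1) xpredT) //=.
apply: eq_bigr => k _; rewrite (eq_bigr (fun=> t ^+ k)); last first.
  by move=> X /andP[_ /eqP <-]; rewrite inordK // ltnS max_card.
rewrite sumr_const mulr_natl; congr (_ *+ _); apply: eq_card => X.
by rewrite unfold_in inE -val_eqE /= inordK // ltnS max_card.
Qed.

Lemma iso_cut_poly (R : nzSemiRingType) G H (t : R) :
  isomorphic G H -> cut_poly G t = cut_poly H t.
Proof.
move=> iGH; rewrite !cut_polyE (iso_card iGH).2.
by apply: eq_bigr => k _; rewrite (iso_cut_number _ iGH).
Qed.

Lemma unreliabilityE (R : realType) (G : mgraph) (t : R) : 0 <= t ->
  unreliability G (t / (1 + t)) = cut_poly G t / (1 + t) ^+ #|edge G|.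
Proof.
move=> t0; rewrite /unreliability /cut_poly mulr_suml; apply: eq_bigr => X _.
have t1 : 1 + t != 0 by rewrite gt_eqF // ltr_wpDr.
have -> : 1 - t / (1 + t) = (1 + t)^-1 by field.
have XE : (#|X| <= #|edge G|)%N := max_card _.
rewrite -{2}(subnKC XE) expr_div_n exprVn exprD invfM -!mulrA.
by congr (_ * _).
Qed.

Lemma umr_cut_poly (R : realType) G H (t : R) :
  uniformly_most_reliable R G ->
  #|vert H| = #|vert G| -> #|edge H| = #|edge G| -> 0 <= t ->
  cut_poly G t <= cut_poly H t.
Proof.
move=> uG HV HE t0; have t1 : 0 < 1 + t by rewrite ltr_wpDr.
have p01 : 0 <= t / (1 + t) <= 1.
  by rewrite divr_ge0 ?(ltW t1) //= ler_pdivrMr // mul1r lerDr.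
have := uG H HV HE _ p01.
by rewrite !unreliabilityE // HE ler_pM2r // invr_gt0 exprn_gt0.
Qed.

(** Cut numbers are integers, so an excess at the first difference is at least 1 and would dominate
    the difference of the two polynomials at a small positive argument. *)
Lemma umr_cut_number (R : realType) G H (k : nat) :
  uniformly_most_reliable R G ->
  #|vert H| = #|vert G| -> #|edge H| = #|edge G| ->
  (forall i, (i < k)%N -> cut_number G i = cut_number H i) ->
  (cut_number G k <= cut_number H k)%N.
Proof.
move=> uG HV HE eqk; rewrite leqNgt; apply/negP => lk.
have km : (k <= #|edge G|)%N.
  have : (0 < cut_number G k)%N by apply: leq_trans lk.
  by case/card_gt0P=> X; rewrite inE => /andP[_ /eqP <-]; apply: max_card.
pose a i : R := (cut_number G i)%:R - (cut_number H i)%:R.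
pose B := \sum_(i < #|edge G|.+1) `|a i|.
have B0 : 0 <= B by apply: sumr_ge0.
pose x : R := (2 * (B * #|edge G|.+1%:R) + 1)^-1.
have Bm : 0 <= B * #|edge G|.+1%:R by rewrite mulr_ge0.
have d0 : 0 < 2 * (B * #|edge G|.+1%:R) + 1 by lra.
have x0 : 0 < x by rewrite invr_gt0.
have x1 : x <= 1 by rewrite invf_le1 //; lra.
have : x ^+ k * (1 / 2) <= \sum_(i < #|edge G|.+1) a i * x ^+ i.
  apply: (@dominant_coef _ a _ _ B) => //.
  - by move=> i /eqk eqi; rewrite /a eqi subrr.
  - by rewrite /a lerBrDr addrC natr1 ler_nat.
  - move=> i im; rewrite /B (bigD1 (Ordinal (im : (i < #|edge G|.+1)%N))) //=.
    by rewrite lerDl sumr_ge0.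
  - by rewrite x0 x1.
  - by rewrite mulrC ler_pdivrMr //; lra.
have := umr_cut_poly uG HV HE (ltW x0); rewrite !cut_polyE HE.
under [X in _ -> _ <= X -> _]eq_bigr do rewrite mulrBl.
rewrite sumrB => h1 h2; have :
  0 < x ^+ k * (1 / 2) by rewrite mulr_gt0 ?exprn_gt0 //; lra.
lra.
Qed.

(** The generating function of [gamma M k j]: expanding the power of [1 + y] sums over the subsets
    [J]. For [t = x / c] and [y = 1 / c], a short chain has weight [c t = x] and a long one
    [(c + 1) t = x (1 + y)]. *)
Definition gamma_poly (R : nzSemiRingType) (M : marked_graph) (x y : R) : R :=
  \sum_(X : {set edge (base M)} | cut_set X) x ^+ #|X| * (1 + y) ^+ #|X :&:
    long M|.

Lemma gammaE (M : marked_graph) k j :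
  gamma M k j = (\sum_(X : {set edge (base M)} | cut_set X && (#|X| == k))
    'C(#|X :&: long M|, j))%N.
Proof.
rewrite /gamma -sum1_card.
rewrite (eq_bigr (fun X : {set edge (base M)} =>
  \sum_(J : {set edge (base M)} | (J \subset X :&: long M) && (#|J| == j))
    1)%N); last first.
  by move=> X _; rewrite -cards_draws -sum1dep_card.
rewrite pair_big_dep /=; apply: eq_bigl => -[X J].
by rewrite inE /= andbA.
Qed.

Lemma gamma_polyE (R : comNzRingType) (M : marked_graph) (x y : R) :
  gamma_poly M x y = \sum_(j < #|edge (base M)|.+1)
    (\sum_(k < #|edge (base M)|.+1) (gamma M k j)%:R * x ^+ k) * y ^+ j.
Proof.
set Q := #|edge (base M)|.
have -> : gamma_poly M x y =
  \sum_(j < Q.+1) \sum_(X : {set edge (base M)} | cut_set X)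
    'C(#|X :&: long M|, j)%:R * x ^+ #|X| * y ^+ j.
  rewrite exchange_big /=; apply: eq_bigr => X _.
  rewrite exprDn (big_ord_widen Q.+1 (fun i =>
    (1 ^+ (#|X :&: long M| - i) * y ^+ i) *+ 'C(#|X :&: long M|,
      i))) ?ltnS ?max_card //.
  rewrite mulr_sumr [LHS]big_mkcond /=; apply: eq_bigr => i _.
  case: ltnP => li; last by rewrite bin_small // !mul0r.
  by rewrite expr1n mul1r -mulr_natl; ring.
apply: eq_bigr => j _; rewrite mulr_suml.
rewrite (partition_big (fun X : {set edge (base M)} =>
  inord #|X| : 'I_Q.+1) xpredT) //=.
apply: eq_bigr => k _; rewrite gammaE natr_sum 2!mulr_suml.
apply: eq_big => [X|X /andP[_ /eqP <-]].
  by rewrite -val_eqE /= inordK // ltnS max_card.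
by rewrite inordK // ltnS max_card.
Qed.

(** * Cut polynomials of marked structures *)

Definition chain_len (M : marked_graph) (c : nat) (e : edge (base M)) :=
  if e \in long M then c.+1 else c.
Arguments chain_len : clear implicits.

Lemma prodrD1 (R : comNzRingType) (T : finType) (F : T -> R) :
  \prod_i (F i + 1) = \sum_(X : {set T}) \prod_(i in X) F i.
Proof.
by rewrite bigA_distr; apply: eq_bigr => X _; rewrite [RHS]big_mkcond.
Qed.

Lemma cut_poly_noncut (R : comNzRingType) (G : mgraph) (t : R) :
  cut_poly G t + \sum_(X : {set edge G} | ~~ cut_set X) t ^+ #|X| =
  (1 + t) ^+ #|edge G|.
Proof.
rewrite -(bigID (@cut_set G) xpredT) /= addrC -prodr_const prodrD1.
by apply: eq_bigr => X _; rewrite prodr_const.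
Qed.

(** The product formula over the chains holds for non-cut sets, so complements are taken twice:
    first in the subdivision, then in the base with weighted edges. The first two terms depend only
    on the numbers of edges and of long chains. *)
Lemma cut_poly_subdivision (R : fieldType) (M : marked_graph) (c : nat) (x :
  R) :
  (0 < c)%N -> c%:R != 0 :> R ->
  cut_poly (subdivision (chain_len M c)) (x / c%:R) =
  (1 + x / c%:R) ^+ #|edge (subdivision (chain_len M c))|
  - (1 + x) ^+ (#|edge (base M)| - #|long M|) *
    (1 + x * (1 + c%:R^-1)) ^+ #|long M|
  + gamma_poly M x c%:R^-1.
Proof.
move=> c0 cR; set t := x / c%:R.
have lgt0 e : (0 < chain_len M c e)%N by rewrite /chain_len; case: ifP.
have w e : (chain_len M c e)%:R * t =
  if e \in long M then x * (1 + c%:R^-1) else x.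
  by rewrite /chain_len /t; case: ifP => _; rewrite -?natr1; field.
have prodE (Y : {set edge (base M)}) :
    \prod_(e in Y) ((chain_len M c e)%:R * t) =
      x ^+ #|Y| * (1 + c%:R^-1) ^+ #|Y :&: long M|.
  rewrite (eq_bigr (fun e => x * if e \in long M then 1 + c%:R^-1 else 1));
    last first.
    by move=> e _; rewrite w; case: ifP; rewrite ?mulr1.
  rewrite big_split /= prodr_const -big_mkcondr /= prodr_const.
  by congr (_ * _ ^+ _); apply: eq_card => e; rewrite !inE.
have all_sets := cut_poly_noncut (subdivision (chain_len M c)) t.
have all_base : \sum_(Y : {set edge (base M)} | ~~ cut_set Y)
      \prod_(e in Y) ((chain_len M c e)%:R * t) + gamma_poly M x c%:R^-1 =
    (1 + x) ^+ (#|edge (base M)| - #|long M|) *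
      (1 + x * (1 + c%:R^-1)) ^+ #|long M|.
  under [gamma_poly _ _ _]eq_bigr do rewrite -prodE.
  rewrite addrC -(bigID (@cut_set (base M)) xpredT) /= -prodrD1 (bigID (mem
    (long M))) /= mulrC; congr (_ * _).
    rewrite (eq_bigr (fun=> 1 + x)) => [|e /negbTE eL];
      last by rewrite w eL addrC.
    rewrite prodr_const; congr (_ ^+ _).
    by rewrite -(cardC (mem (long M))) addKn; apply: eq_card.
  rewrite (eq_bigr (fun=> 1 + x * (1 + c%:R^-1))) => [|e eL];
    last by rewrite w eL addrC.
  by rewrite prodr_const.
by rewrite -all_base -all_sets sum_noncut_subdivision //; ring.
Qed.

(** * The first difference of the gamma coefficients *)

Lemma gamma_bound (M : marked_graph) k j :
  (gamma M k j <= 2 ^ #|edge (base M)| * 2 ^ #|edge (base M)|)%N.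
Proof.
apply: leq_trans (max_card _) _.
by rewrite card_prod -!cardsT -powersetT !card_powerset !cardsT.
Qed.

(* At [x = 1 / separation Q] the first nonzero coefficient of a polynomial of
   degree at most [Q] in [x] with integer coefficients bounded by
   [2 ^ Q * 2 ^ Q] determines its sign. *)
Definition separation (Q : nat) : nat :=
  (2 * (2 ^ Q * 2 ^ Q * Q.+1))%N.

(** Above this bound on [c], [dominant_coef] applies in the variable [1 / c], with leading
    coefficient at least [x ^+ Q / 2] at [x = 1 / separation Q] and all coefficients at most
    [2 ^ Q * 2 ^ Q * Q.+1]. *)
Definition min_length (Q : nat) : nat :=
  (4 * separation Q ^ Q * (2 ^ Q * 2 ^ Q * Q.+1 * Q.+1))%N.

(** [dominant_coef] is used twice: in [x], to bound the coefficient [b j0] from below, and then in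
    [1 / c], where [b j0] decides the sign. As [c] is large in terms of [x], the index [j] takes
    precedence over [k]. *)
Lemma gamma_first_difference (R : realFieldType) (M M' :
  marked_graph) (Q c j0 k0 : nat) :
  #|edge (base M)| = Q -> #|edge (base M')| = Q -> (min_length Q < c)%N ->
  (forall x : R, 0 <= x -> gamma_poly M x c%:R^-1 <= gamma_poly M' x c%:R^-1) ->
  (j0 <= Q)%N -> (k0 <= Q)%N ->
  (forall j k, (k <= Q)%N -> (j < j0)%N || (j == j0) && (k < k0)%N ->
    gamma M k j = gamma M' k j) ->
  (gamma M k0 j0 <= gamma M' k0 j0)%N.
Proof.
move=> MQ M'Q cQ leM jQ kQ eqM; rewrite leqNgt; apply/negP => lt0.
pose a j k : R := (gamma M k j)%:R - (gamma M' k j)%:R.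
pose B : R := (2 ^ Q * 2 ^ Q)%:R.
have aB j k : `|a j k| <= B.
  have g0 : (gamma M k j)%:R <= B by rewrite ler_nat -MQ gamma_bound.
  have g1 : (gamma M' k j)%:R <= B by rewrite ler_nat -M'Q gamma_bound.
  have h0 : 0 <= (gamma M k j)%:R :> R by [].
  have h1 : 0 <= (gamma M' k j)%:R :> R by [].
  by rewrite ler_norml /a; apply/andP; split; lra.
have sep0 : (0 < separation Q)%N by rewrite !muln_gt0 !expn_gt0.
pose x : R := (separation Q)%:R^-1.
have x0 : 0 < x by rewrite invr_gt0 ltr0n.
have x1 : x <= 1 by rewrite invf_le1 ?ltr0n // ler1n.
pose b j := \sum_(k < Q.+1) a j k * x ^+ k.
have bj0 : x ^+ Q / 2 <= b j0.
  apply: (@le_trans _ _ (x ^+ k0 * (1 / 2))).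
    by have := ler_wiXn2l (ltW x0) x1 kQ; lra.
  apply: (dominant_coef (B := B)) => //.
  - by move=> k kk; rewrite /a eqM ?subrr ?eqxx ?kk ?orbT // ltnW // (leq_trans
    kk).
  - by rewrite /a lerBrDr addrC natr1 ler_nat.
  - by rewrite x0 x1.
  have : x * (2 * (B * Q.+1%:R)) = 1.
    by rewrite /x /separation /B -!natrM mulVf // pnatr_eq0 -lt0n.
  by lra.
have c0 : (0 < c)%N by apply: leq_ltn_trans cQ.
have cR : 0 < c%:R :> R by rewrite ltr0n.
have y1 : c%:R^-1 <= 1 :> R by rewrite invf_le1 // ler1n.
have : c%:R^-1 ^+ j0 * (x ^+ Q / 2 / 2) <= \sum_(j < Q.+1) b j * c%:R^-1 ^+ j.
  apply: (dominant_coef (B := B * Q.+1%:R)) => //.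
  - move=> j jj; rewrite /b big1 // => k _; rewrite /a eqM ?subrr ?mul0r ?jj //.
    by rewrite -ltnS ltn_ord.
  - move=> j _; apply: le_trans (ler_norm_sum _ _ _) _.
    apply: (@le_trans _ _ (\sum_(k < Q.+1) B)).
      apply: ler_sum => k _; rewrite normrM -[leRHS]mulr1;
        apply: ler_pM (aB _ _) _ => //.
      by rewrite ger0_norm ?exprn_ge0 ?exprn_ile1 // ltW.
    by rewrite sumr_const card_ord mulr_natr.
  - by rewrite invr_gt0 cR y1.
  rewrite mulrC ler_pdivrMr // /x exprVn.
  have sQ : 0 < (separation Q)%:R ^+ Q :> R by rewrite exprn_gt0 // ltr0n.
  have -> : ((separation Q)%:R ^+ Q)^-1 / 2 / 2 * c%:R =
    c%:R / (4 * (separation Q)%:R ^+ Q) :> R.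
    by field; rewrite gt_eqF.
  rewrite ler_pdivlMr; last by rewrite mulr_gt0.
  by rewrite /B -natrX -!natrM ler_nat (leq_trans _ (ltnW cQ)) // /min_length;
    lia.
have := leM x (ltW x0); rewrite !gamma_polyE MQ M'Q -subr_ge0 -sumrB => h1 h2.
have : 0 < c%:R^-1 ^+ j0 * (x ^+ Q / 2 / 2) :> R.
  by rewrite mulr_gt0 ?exprn_gt0 ?invr_gt0 // !divr_gt0 ?exprn_gt0.
suff : \sum_(j < Q.+1) b j * c%:R^-1 ^+ j = - \sum_(i < Q.+1)
        ((\sum_(k < Q.+1) (gamma M' k i)%:R * x ^+ k) * c%:R^-1 ^+ i -
         (\sum_(k < Q.+1) (gamma M k i)%:R * x ^+ k) * c%:R^-1 ^+ i) by lra.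
rewrite -sumrN; apply: eq_bigr => j _; rewrite opprB -mulrBl -sumrB /b.
by congr (_ * _); apply: eq_bigr => k _; rewrite /a mulrBl.
Qed.

(** * Lexicographic comparison of the coefficient sequences *)

Lemma seqlexi_map_le (T : eqType) (f g : T -> nat) (s : seq T) :
  (forall s1 x s2, s = s1 ++ x :: s2 -> {in s1, f =1 g} -> (f x <= g x)%N) ->
  ((map f s : seqlexi nat) <= (map g s : seqlexi nat))%O.
Proof.
elim: s => [|x s IH] H //=.
have fgx : (f x <= g x)%N by apply: (H [::] x s).
rewrite lexi_cons !leEnat fgx /=; apply/implyP => gfx.
have fg : f x = g x by apply/eqP; rewrite eqn_leq fgx.
apply: IH => s1 y s2 es h; apply: (H (x :: s1) y s2); rewrite ?es // => z.
by rewrite inE => /predU1P[->|/h].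
Qed.

Definition index_lt (p q : nat * nat) :=
  (p.1 < q.1)%N || (p.1 == q.1) && (p.2 < q.2)%N.

Lemma pairwise_allpairs (s : seq nat) (t : nat -> seq nat) :
  pairwise ltn s -> (forall j, pairwise ltn (t j)) ->
  pairwise index_lt [seq (j, k) | j <- s, k <- t j].
Proof.
move=> ps pt; elim: s ps => //= j s IH /andP[/allP js ps].
rewrite pairwise_cat IH // andbT; apply/andP; split.
  apply/allrelP => _ _ /mapP[k _ ->] /allpairsPdep[i [l [i_s _ ->]]].
  by rewrite /index_lt /=; have /= -> := js _ i_s.
rewrite pairwise_map; apply: sub_pairwise (pt j) => k l /= kl.
by rewrite /index_lt /= eqxx kl orbT.
Qed.

Definition gamma_indices (Q : nat) : seq (nat * nat) :=
  [seq (j, k) | j <- iota 0 Q.+1, k <- [seq k <- iota 1 Q | (j <= k)%N]].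

Lemma gamma_seqE r M : gamma_seq r M =
  [seq gamma M p.2 p.1 | p <- gamma_indices (3 * (r - 1))].
Proof. by rewrite /gamma_seq /gamma_indices map_allpairs. Qed.

Lemma mem_gamma_indices Q j k :
  ((j, k) \in gamma_indices Q) = [&& (j <= Q), (0 < k <= Q) & (j <= k)]%N.
Proof.
apply/allpairsPdep/and3P => [[i [l [iQ]]]|[jQ kQ jk]].
  rewrite mem_filter !mem_iota in iQ * => /andP[il lQ] [-> ->].
  by split=> //; lia.
by exists j, k; rewrite mem_filter !mem_iota; split=> //; lia.
Qed.

Lemma gamma_indices_earlier Q s1 j k s2 : gamma_indices Q = s1 ++ (j,
  k) :: s2 ->
  forall p, p \in gamma_indices Q -> index_lt p (j, k) -> p \in s1.
Proof.
move=> e p; have : pairwise index_lt (gamma_indices Q).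
  apply: pairwise_allpairs => [|i];
    first by rewrite -sorted_pairwise ?iota_ltn_sorted //; exact: ltn_trans.
  by apply: pairwise_filter; rewrite -sorted_pairwise ?iota_ltn_sorted //;
    exact: ltn_trans.
rewrite e pairwise_cat => /and3P[_ _] /= /andP[/allP pj _].
rewrite mem_cat inE => /or3P[//|/eqP->|/pj]; rewrite /index_lt; lia.
Qed.

Lemma gamma_gt_size M k j : (k < j)%N -> gamma M k j = 0%N.
Proof.
move=> kj; rewrite gammaE big1 // => X /andP[_ /eqP kX]; apply: bin_small.
by apply: leq_ltn_trans kj; rewrite -kX subset_leq_card // subsetIl.
Qed.

Lemma gamma_size0 M j : ~~ cut_set (set0 :
  {set edge (base M)}) -> gamma M 0 j = 0%N.
Proof.
move=> n0; rewrite gammaE big1 // => X /andP[cX]; rewrite cards_eq0 => /eqP X0.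
by move: n0; rewrite -X0 cX.
Qed.

Lemma inj_of_card (T T' : finType) (A : {set T}) (A' : {set T'}) :
  #|T| = #|T'| -> #|A| = #|A'| ->
  exists2 f : T -> T', injective f & forall x, x \in A -> f x \in A'.
Proof.
move=> TT AA; case: (pickP T') => [x0 _|no]; last first.
  have noT (x : T) : False.
    by apply: (fintype0 x); rewrite TT; apply: eq_card0.
  by exists (fun x => False_rect _ (noT x)) => x; case: (noT x).
have CC : #|~: A| = #|~: A'| by apply/eqP;
  rewrite -(eqn_add2l #|A|) cardsC AA cardsC TT.
pose f (x : T) := if x \in A then nth x0 (enum A') (index x (enum A))
  else nth x0 (enum (~: A')) (index x (enum (~: A))).
have i1 x : x \in A -> (index x (enum A) < size (enum A'))%N.
  by move=> xA; rewrite -cardE -AA cardE index_mem mem_enum.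
have i2 x : x \notin A -> (index x (enum (~: A)) < size (enum (~: A')))%N.
  by move=> xA; rewrite -cardE -CC cardE index_mem mem_enum inE.
have fA x : (f x \in A') = (x \in A).
  rewrite /f; case: ifPn => [/i1|/i2] h; have := mem_nth x0 h;
    rewrite mem_enum ?inE //.
  by move/negbTE.
exists f => [x y fxy|x]; last by rewrite fA.
have xy : (x \in A) = (y \in A) by rewrite -!fA fxy.
move: fxy; rewrite /f xy; case: ifPn => yA /eqP.
  rewrite nth_uniq ?enum_uniq ?i1 ?xy // => /eqP.
  by move=> ixy; apply: (index_inj x _ _ ixy); rewrite mem_enum ?xy.
rewrite nth_uniq ?enum_uniq ?i2 ?xy // => /eqP.
by move=> ixy; apply: (index_inj x _ _ ixy); rewrite mem_enum inE ?xy.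
Qed.

(** Every edge set of a disconnected base is a cut set, so an injection of the edges that respects
    long chains sends counted pairs to counted pairs. *)
Lemma gamma_disconnected M M' k j :
  #|edge (base M)| = #|edge (base M')| -> #|long M| = #|long M'| ->
  cut_set (set0 : {set edge (base M')}) -> (gamma M k j <= gamma M' k j)%N.
Proof.
move=> EE LL c0; have [f injf fL] := inj_of_card EE LL.
pose F (XJ : {set edge (base M)} * {set edge (base M)}) := (f @: XJ.1,
  f @: XJ.2).
have injF : injective F.
  by move=> [X J] [X' J'] [/(imset_inj injf)-> /(imset_inj injf)->].
rewrite /gamma -(card_imset _ injF); apply: subset_leq_card;
  apply/subsetP => XJ.
case/imsetP => -[X J]; rewrite inE /= => /and4P[_ kX JXL jJ] ->.
rewrite inE /= !card_imset // kX jJ (cut_setS _ c0) ?sub0set //= andbT.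
apply/subsetP => _ /imsetP[e /(subsetP JXL) + ->]; rewrite !inE => /andP[eX eL].
by rewrite imset_f //= fL.
Qed.

Lemma gamma_le_of_poly (R : realFieldType) (M M' : marked_graph) (r c : nat) :
  #|edge (base M)| = (3 * (r - 1))%N -> #|edge (base M')| = (3 * (r - 1))%N ->
  #|long M| = #|long M'| ->
  ~~ cut_set (set0 : {set edge (base M)}) ->
  (min_length (3 * (r - 1)) < c)%N ->
  (forall x : R, 0 <= x -> gamma_poly M x c%:R^-1 <= gamma_poly M' x c%:R^-1) ->
  gamma_le r M M'.
Proof.
move=> MQ M'Q LL nM cQ leM; rewrite /gamma_le !gamma_seqE.
apply: seqlexi_map_le => s1 [j k] s2 es eqs1 /=.
(* A disconnected competitor is treated apart: the coefficients with [k = 0], absent from the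
   sequence, vanish when the base is connected. *)
have [cM'|nM'] := boolP (cut_set (set0 : {set edge (base M')})).
  by apply: gamma_disconnected; rewrite ?MQ ?M'Q.
have : (j, k) \in gamma_indices (3 * (r - 1)) by rewrite es mem_cat inE eqxx
  orbT.
rewrite mem_gamma_indices => /and3P[jQ /andP[k0 kQ] jk].
apply: (gamma_first_difference MQ M'Q cQ leM) => // j' k' kQ' lt'.
(* Indices with [k' = 0] or [k' < j'] are not listed in the sequence, but there both coefficients
   are zero. *)
case: (posnP k') => [->|k'0]; first by rewrite !gamma_size0.
case: (ltnP k' j') => [kj'|jk']; first by rewrite !gamma_gt_size.
apply: (eqs1 (j', k')); apply: (gamma_indices_earlier es) => //.
by rewrite mem_gamma_indices k'0 kQ' jk' (leq_trans jk').
Qed.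

(** * The structure of uniformly most reliable graphs *)

Local Open Scope nat_scope.

Lemma bin2_double n : ('C(n, 2) * 2 = n * n.-1)%N.
Proof. by elim: n => // n IH; rewrite binS bin1 mulnDl IH;
  case: n {IH} => //= n; lia. Qed.

(** Twice the difference of the two sides is [(l - c) (l - c - 1)], a product of consecutive
    integers; [d * d.+1] is this product in natural numbers. *)
Lemma bin2_tangent c l :
  (c * l <= 'C(l, 2) + 'C(c.+1, 2) ?= iff (l == c) || (l == c.+1))%N.
Proof.
have ll : (l * l.-1 + l = l * l)%N by case: l => //= l; lia.
have bl := bin2_double l; have bc := bin2_double c.+1; rewrite /= in bc.
have [d dE d0] : exists2 d, ('C(l, 2) + 'C(c.+1,
  2)) * 2 = c * l * 2 + d * d.+1 &
    (d == 0) = ((l == c) || (l == c.+1)).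
  case: (leqP l c) => [lc|cl].
    exists (c - l); last by apply/idP/idP; lia.
    by have [d cE] : exists d, c = l + d by [exists (c - l); lia]; subst c;
      rewrite addKn; lia.
  exists (l - c.+1); last by apply/idP/idP; lia.
  have [d lE] : exists d, l = c.+1 + d by exists (l - c.+1); lia.
  by subst l; rewrite addKn; lia.
split; first by lia.
rewrite -d0; apply/eqP/eqP => [h|d00]; last by rewrite d00 in dE; lia.
have : d * d.+1 = 0 by lia.
by case: d {dE d0}.
Qed.

Local Open Scope ring_scope.

Lemma exists_set_card (T : finType) (m : nat) :
  (m <= #|T|)%N -> exists A : {set T}, #|A| = m.
Proof.
move=> mT; exists [set x in take m (enum T)].
rewrite cardsE; have /card_uniqP -> := take_uniq m (enum_uniq T).
by rewrite size_takel // -cardE.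
Qed.

Lemma cut_number_eq0 G k (X : {set edge G}) :
  cut_number G k = 0%N -> #|X| = k -> ~~ cut_set X.
Proof.
move=> /eqP; rewrite cards_eq0 => /eqP/setP/(_ X); rewrite !inE => h Xk.
by move: h; rewrite Xk eqxx andbT => ->.
Qed.

Lemma degree_ge2 (G : mgraph) : (1 < #|vert G|)%N ->
  (forall X : {set edge G}, (#|X| <= 1)%N -> ~~ cut_set X) ->
  forall v : vert G, (2 <= degree v)%N.
Proof.
move=> V1 small v; rewrite leqNgt; apply/negP => dv.
pose X := [set e : edge G | (ends e).1 == v] :|: [set e :
  edge G | (ends e).2 == v].
have X1 : (#|X| <= 1)%N by rewrite -ltnS (leq_ltn_trans _ dv) // leq_card_setU.
have [w wv] : exists w, w != v.
  have : (0 < #|[set~ v]|)%N by rewrite cardsC1; lia.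
  by case/card_gt0P => w; rewrite !inE; exists w.
have /negP[] := small X X1.
apply: (@cutP _ _ (pred1 v) v w); last by rewrite /= eqxx (negbTE wv).
by move=> e; rewrite !inE negb_or => /andP[/negbTE /= -> /negbTE ->].
Qed.

Lemma cards_redundancy G n r : #|vert G| = n -> redundancy G = r%:Z ->
  (#|edge G| + 1 = n + r)%N.
Proof. by rewrite /redundancy => ->; lia. Qed.

Section ChainLength.
Variables (M : marked_graph) (c : nat).

Lemma chain_len_gt0 : (0 < c)%N -> forall e, (0 < chain_len M c e)%N.
Proof. by move=> c0 e; rewrite /chain_len; case: ifP. Qed.

Lemma sum_chain_len :
  (\sum_e chain_len M c e = c * #|edge (base M)| + #|long M|)%N.
Proof.
rewrite (eq_bigr (fun e => c + (e \in long M))%N); last first.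
  by move=> e _; rewrite /chain_len; case: ifP; rewrite ?addn1 ?addn0.
rewrite big_split /= sum_nat_const mulnC; congr addn.
by rewrite -sum1_card [RHS]big_mkcond; apply: eq_bigr => e _; case: (e \in _).
Qed.

Lemma card_edge_marked : #|edge (subdivision (chain_len M c))| =
  (c * #|edge (base M)| + #|long M|)%N.
Proof. by rewrite card_subdivision_edge sum_chain_len. Qed.

Lemma card_vert_marked : (0 < c)%N -> #|vert (subdivision (chain_len M c))| =
  (#|vert (base M)| + (c - 1) * #|edge (base M)| + #|long M|)%N.
Proof.
move=> c0; rewrite card_subdivision_vert -addnA; congr addn.
have : (\sum_e (chain_len M c e).-1 + #|edge (base M)| =
  \sum_e chain_len M c e)%N.
  by rewrite -sum1_card -big_split; apply: eq_bigr => e _;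
    rewrite /= addn1 prednK // chain_len_gt0.
rewrite sum_chain_len; case: c c0 => // c' _; rewrite subn1 mulSn /=; lia.
Qed.

End ChainLength.

Lemma card_edge_cubic r lam M : marked_structure r lam M ->
  #|edge (base M)| = (3 * (r - 1))%N.
Proof.
case=> VM dM _; have := sum_degree (base M).
by rewrite (eq_bigr (fun=> 3%N)) // sum_nat_const -[#|_|]/#|vert (base M)| VM;
  lia.
Qed.

Lemma umr_structure (R : realType) (r c lam : nat) (G : mgraph) :
  (2 <= r)%N -> (0 < c)%N -> (lam < 3 * (r - 1))%N ->
  #|vert G| = (2 * (r - 1) + (c - 1) * (3 * (r - 1)) + lam)%N ->
  redundancy G = r%:Z -> uniformly_most_reliable R G ->
  exists M, [/\ marked_structure r lam M, has_marked_structure c G M &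
    ~~ cut_set (set0 : {set edge (base M)})].
Proof.
move=> r2 c0 lamQ VG rG uG; have EVG := cards_redundancy erefl rG;
  have EG := EVG; rewrite VG in EG.
set Q := (3 * (r - 1))%N in lamQ VG EG *.
have {}EG : #|edge G| = (c * Q + lam)%N by case: c c0 VG EG => // c' _;
  rewrite /Q; nia.
pose W := moebius_ladder (r - 1).
have EW : #|edge W| = Q by rewrite card_sum !card_ord /Q; lia.
have [L Llam] : exists L : {set edge W}, #|L| = lam by apply: exists_set_card;
  rewrite EW ltnW.
pose N := @MarkedGraph W L; pose H := subdivision (chain_len N c).
have HE : #|edge H| = #|edge G| by rewrite card_edge_marked EW Llam EG.
have HV : #|vert H| = #|vert G|.
  by rewrite card_vert_marked // card_ord EW Llam VG.
have W3 : three_edge_connected W by apply: moebius_three_edge_connected; lia.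
have [H0 H1 H2] := three_edge_connected_cut_number (chain_len_gt0 (M :=
  N) c0) W3.
have leGH k : (forall i, (i < k)%N -> cut_number G i = cut_number H i) ->
    (cut_number G k <= cut_number H k)%N by apply: (umr_cut_number uG).
have G0 : cut_number G 0 = 0%N.
  by have := leGH 0%N; rewrite H0 leqn0 => /(_ _)/eqP; apply.
have G1 : cut_number G 1 = 0%N.
  have := leGH 1%N; rewrite H1 leqn0 => /(_ _)/eqP; apply.
  by case=> // _; rewrite G0 H0.
have G2 : (cut_number G 2 <= \sum_e 'C(chain_len N c e, 2))%N.
  rewrite -H2; apply: leGH => -[|[|//]] _; first by rewrite G0 H0.
  by rewrite G1 H1.
have Gsmall (X : {set edge G}) : (#|X| <= 1)%N -> ~~ cut_set X.
  rewrite leq_eqVlt ltnS leqn0 => /orP[] /eqP.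
    exact: cut_number_eq0.
  exact: cut_number_eq0.
have dG : forall v : vert G, (2 <= degree v)%N.
  by apply: degree_ge2 => //; rewrite VG -addnA;
    apply: (leq_trans _ (leq_addr _ _)); lia.
(* With all degrees equal to 2 there would be as many edges as vertices, that is [r = 1]. *)
have nG : exists v : vert G, degree v != 2.
  apply/existsP; apply: contraT; rewrite negb_exists => /forallP d2.
  have := sum_degree G; rewrite (eq_bigr (fun=> 2%N)) => [|v _]; last first.
    by apply/eqP; have := d2 v; rewrite negbK.
  by rewrite sum_nat_const -[#|_|]/#|vert G|; lia.
have cG : ~~ cut_set (set0 : {set edge G}) by apply: Gsmall; rewrite cards0.
have [S [len [iG lgt0 dS]]] := chain_decomposition cG dG nG.
have [VGS EGS] := iso_card iG.
have sumlen : (\sum_e len e =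
  c * Q + lam)%N by rewrite -card_subdivision_edge -EGS EG.
have VS : (#|vert S| + \sum_e len e = #|vert G| + #|edge S|)%N.
  rewrite VGS card_subdivision_vert -addnA; congr addn.
  rewrite -sum1_card -big_split; apply: eq_bigr => e _.
  by rewrite /= addn1 prednK.
have {}VS : (#|vert S| + (r - 1) = #|edge S|)%N.
  by move: VS; rewrite sumlen -EG; lia.
have dsum := sum_degree S.
have dle : (3 * #|vert S| <= 2 * #|edge S|)%N.
  by rewrite -dsum mulnC -sum_nat_const; apply: leq_sum => v _; apply: dS.
have ESQ : (#|edge S| <= Q)%N by rewrite /Q; lia.
have C2 : (\sum_e 'C(len e, 2) <= \sum_e 'C(chain_len N c e, 2))%N.
  apply: leq_trans G2; rewrite (iso_cut_number _ iG); exact: cut_fiber_pair.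
(* The tangent bound is summed over the chains of [G] and, with equality, over those of [H]. The
   total lengths agree, so with [C2] and [#|edge S| <= Q] all inequalities are tight; as
   ['C(c.+1, 2)] is positive, this gives [#|edge S| = Q] and all lengths in [{c, c + 1}]. *)
have tang := leqif_sum (fun (e : edge S) (_ : true) => bin2_tangent c (len e)).
have tangN : (\sum_e c * chain_len N c e = \sum_e ('C(chain_len N c e,
  2) + 'C(c.+1, 2)))%N.
  apply: eq_bigr => e _; apply/eqP; rewrite (bin2_tangent _ _) /chain_len.
  by case: ifP; rewrite eqxx ?orbT.
have sumS : (\sum_e ('C(len e, 2) + 'C(c.+1, 2)) = \sum_e 'C(len e,
  2) + #|edge S| * 'C(c.+1, 2))%N.
  by rewrite big_split sum_nat_const.
have sumN : (\sum_e ('C(chain_len N c e, 2) + 'C(c.+1, 2)) =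
    \sum_e 'C(chain_len N c e, 2) + Q * 'C(c.+1, 2))%N.
  by rewrite big_split sum_nat_const EW.
have leS : (\sum_e c * len e <= \sum_e ('C(len e, 2) + 'C(c.+1,
  2)))%N by apply: tang.
have csum : (\sum_e c * len e = \sum_e c * chain_len N c e)%N.
  by rewrite -!big_distrr; congr muln; rewrite sumlen -EW -Llam;
    apply/esym/sum_chain_len.
have bc : (0 < 'C(c.+1, 2))%N by rewrite bin_gt0.
have mulle : (#|edge S| * 'C(c.+1, 2) <= Q * 'C(c.+1,
  2))%N by rewrite leq_mul2r ESQ orbT.
have {}ESQ : #|edge S| = Q.
  by apply/eqP; rewrite -(eqn_pmul2r bc); lia.
have VS2 : #|vert S| = (2 * (r - 1))%N by move: VS; rewrite ESQ /Q; lia.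
have /eqP : (\sum_e c * len e = \sum_e ('C(len e, 2) + 'C(c.+1, 2)))%N by lia.
rewrite tang => /forallP lenc.
pose L' := [set e : edge S | len e == c.+1]; pose M := @MarkedGraph S L'.
have lenE : len = chain_len M c.
  apply/funext => e; rewrite /chain_len inE; have /= := lenc e.
  by case: eqP => [->|_ /=]; [case: eqP => // /eqP;
    rewrite -ltn_eqF | case: eqP].
exists M; split.
- split.
  + exact: VS2.
  (* All degrees are at least 3 and their sum is three times the number of vertices, so [S] is
     cubic. *)
  + have tight := leqif_sum (fun (v : vert S) (_ : true) => leqif_eq (dS v)).
    have : (\sum_(v : vert S) 3 == \sum_(v : vert S) degree v)%N.
      by rewrite dsum sum_nat_const -[#|_|]/#|vert S| VS2 ESQ /Q; lia.
    by rewrite tight => /forallP dv v; apply/esym/eqP/(dv v).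
  + have := sum_chain_len M c; rewrite -lenE sumlen ESQ; lia.
- by rewrite /has_marked_structure -/(chain_len M c) -lenE.
have /(noncut_subdivision lgt0)[_] : ~~ cut_set (set0 :
  {set edge (subdivision len)}).
  by apply: cut_number_eq0 (cards0 _); rewrite -(iso_cut_number _ iG).
by rewrite /touched imset0.
Qed.

Theorem lemma4p1 (R : realType) (r : nat) (hr : (2 <= r)%N) :
  exists n0 : nat, forall n : nat, (n0 < n)%N ->
  forall c lam : nat, (1 <= c)%N -> (lam < 3 * (r - 1))%N ->
  n = (2 * (r - 1) + (c - 1) * (3 * (r - 1)) + lam)%N ->
  forall G : mgraph, #|vert G| = n -> redundancy G = r%:Z ->
  uniformly_most_reliable R G ->
  exists M : marked_graph,
    [/\ marked_structure r lam M,
        has_marked_structure c G M &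
        forall M' : marked_graph, marked_structure r lam M' ->
          gamma_le r M M'].
Proof.
set Q := (3 * (r - 1))%N.
(* Since [n <= Q * c.+1], this choice forces [min_length Q < c]. *)
exists (Q * (min_length Q).+1)%N => n n0 c lam c1 lamQ nE G VG rG uG.
have cQ : (min_length Q < c)%N.
  have : (n <= Q * c.+1)%N by rewrite nE /Q; case: c c1 {nE} => // c' _; nia.
  by move=> /(leq_trans n0); rewrite ltn_mul2l ltnS => /andP[].
rewrite nE in VG; have [M [sM hM cM]] := umr_structure hr c1 lamQ VG rG uG.
exists M; split=> // M' sM'.
have EM := card_edge_cubic sM; have EM' := card_edge_cubic sM'.
have [VM _ LM] := sM; have [VM' _ LM'] := sM'.
apply: (@gamma_le_of_poly R _ _ _ c) => //; first by rewrite LM.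
move=> x x0; have [VGM EGM] := iso_card hM.
have cR : c%:R != 0 :> R by rewrite pnatr_eq0 -lt0n.
have := @umr_cut_poly R G (subdivision (chain_len M' c)) (x / c%:R) uG.
rewrite VGM EGM !card_vert_marked // !card_edge_marked EM EM' VM VM' LM LM'.
rewrite divr_ge0 // => /(_ erefl erefl isT).
(* All terms other than [gamma_poly] are common to the two structures and cancel. *)
rewrite (iso_cut_poly _ hM) !cut_poly_subdivision // !card_edge_marked EM EM'
  LM LM'.
by rewrite lerD2l.
Qed.
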